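(* Let $\Lambda$ be a left and right Noetherian ring which is left quasi $\infty$-Gorenstein, and let $M$ be a finitely generated left $\Lambda$-module with $\mathrm{grade}\,M$ finite. Then for every integer $i\ge0$, $$\mathrm{Ext}^i_\Lambda\bigl(\mathrm{Ext}^i_{\Lambda^{op}}(\mathrm{Ext}^{\mathrm{grade}M}_\Lambda(M,\Lambda),\Lambda),\Lambda\bigr)=0$$ if and only if $i\ne\mathrm{grade}\,M$.
   Context: Let $0\to{}_\Lambda\Lambda\to I'_0\to I'_1\to\cdots$ be a minimal injective resolution of $\Lambda$ as a left module. $\Lambda$ is left quasi $\infty$-Gorenstein if the flat dimension of the left module $I'_i$ is at most $i+1$ for all $i\ge0$. For a finitely generated module $M$, $\mathrm{grade}\,M\ge i$ means $\mathrm{Ext}^j(M,\Lambda)=0$ for all $0\le j<i$; so $\mathrm{grade}\,M$ is the least $j\ge0$ with $\mathrm{Ext}^j(M,\Lambda)\ne0$ (and $\infty$ if there is none). $\mathrm{Ext}_\Lambda$ is taken over left modules and $\mathrm{Ext}_{\Lambda^{op}}$ over right modules; $\mathrm{Ext}^0=\mathrm{Hom}$. *)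

(* Defs.v *)
From HB Require Import structures.
From mathcomp Require Import all_boot all_order all_algebra.
From mathcomp Require Import boolp functions.
From mathcomp.multinomials Require Import freeg.

Set Implicit Arguments.
Unset Strict Implicit.
Unset Printing Implicit Defensive.

Import GRing.Theory.
Local Open Scope ring_scope.
Local Open Scope quotient_scope.

(* Left modules over R are [lmodType R]; right modules over R are
   [lmodType R^c], where [a *: x] stands for x a. *)

Definition zero_module (R : nzRingType) (V : lmodType R) : Prop :=
  forall x : V, x = 0.

Section FinitenessConditions.
Variables (R : nzRingType) (V : lmodType R).

Definition finitely_generated : Prop :=
  exists (n : nat) (g : 'I_n -> V),
    forall x : V, exists c : 'I_n -> R, x = \sum_(i < n) c i *: g i.

Definition noetherian_module : Prop :=
  forall N : nat -> {pred V},
    (forall k, submod_closed (N k)) ->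
    (forall k, {subset N k <= N k.+1}) ->
    exists m, forall k, (m <= k)%N -> N k =i N m.

End FinitenessConditions.

Definition left_noetherian (R : nzRingType) : Prop := noetherian_module R^o.
Definition right_noetherian (R : nzRingType) : Prop := left_noetherian R^c.

Section HomologicalModules.
Variable R : nzRingType.

Definition projective_module (P : lmodType R) : Prop :=
  forall (A B : lmodType R) (p : {linear A -> B}) (f : {linear P -> B}),
    (forall b, exists a, p a = b) ->
    exists g : {linear P -> A}, forall x, p (g x) = f x.

Definition injective_module (I : lmodType R) : Prop :=
  forall (A B : lmodType R) (j : {linear A -> B}) (f : {linear A -> I}),
    injective j ->
    exists g : {linear B -> I}, forall x, g (j x) = f x.

Definition essential_image (A B : lmodType R) (f : {linear A -> B}) : Prop :=
  forall N : {pred B}, submod_closed N ->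
    (exists2 x, x \in N & x != 0) ->
    exists2 a, f a \in N & f a != 0.

(* ... -> res_obj 1 -> res_obj 0 -> M -> 0 *)
Record resolution (M : lmodType R) := Resolution {
  res_obj :> nat -> lmodType R;
  res_d : forall n, {linear res_obj n.+1 -> res_obj n};
  res_aug : {linear res_obj 0%N -> M};
  res_aug_surj : forall m, exists x, res_aug x = m;
  res_exact0 : forall x, res_aug x = 0 <-> exists y, res_d 0 y = x;
  res_exactS : forall n x, res_d n x = 0 <-> exists y, res_d n.+1 y = x
}.

Definition projective_resolution M (P : resolution M) : Prop :=
  forall n, projective_module (P n).

(* 0 -> M -> cores_obj 0 -> cores_obj 1 -> ... *)
Record coresolution (M : lmodType R) := Coresolution {
  cores_obj :> nat -> lmodType R;
  cores_d : forall n, {linear cores_obj n -> cores_obj n.+1};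
  cores_aug : {linear M -> cores_obj 0%N};
  cores_aug_inj : injective cores_aug;
  cores_exact0 : forall x, cores_d 0 x = 0 <-> exists m, cores_aug m = x;
  cores_exactS : forall n x,
    cores_d n.+1 x = 0 <-> exists y, cores_d n y = x
}.

(* Minimality: each term is an injective envelope of the image of the
   preceding map. *)
Definition minimal_injective_resolution M (I : coresolution M) : Prop :=
  [/\ forall n, injective_module (I n),
      essential_image (cores_aug I) &
      forall n, essential_image (cores_d I n)].

End HomologicalModules.

Section FreeModule.
Variable R : nzRingType.

Section Lift.
Variables (K : choiceType) (V : lmodType R) (f : K -> V).

Lemma fglift_is_linear : linear (fglift f : {freeg K / R} -> V).
Proof.
have lft0 : fglift f 0 = 0.
  by have := lift_is_additive f 0 0; rewrite !subrr.
have lftD x y : fglift f (x + y) = fglift f x + fglift f y.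
  have lftN z : fglift f (- z) = - fglift f z.
    by have := lift_is_additive f 0 z; rewrite lft0 !sub0r.
  by have := lift_is_additive f x (- y); rewrite !opprK lftN opprK.
have lftS r (F : R * K -> {freeg K / R}) :
    fglift f (\sum_(i <- r) F i) = \sum_(i <- r) fglift f (F i).
  exact: (big_morph _ lftD lft0).
move=> a x y; rewrite lftD; congr (_ + _).
elim/freeg_ind_dom0: x => [|k c D _ _ IH]; first by rewrite !(scaler0, lft0).
rewrite scalerDr !lftD IH scalerDr; congr (_ + _).
suff -> : a *: << k *g c >> = << a * k *g c >> :> {freeg K / R}.
  by rewrite !liftU scalerA.
by apply/eqP/freeg_eqP=> z; rewrite coeffZ !coeffU mulrA.
Qed.

HB.instance Definition _ :=
  GRing.isLinear.Build R {freeg K / R} V _ (fglift f) fglift_is_linear.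

End Lift.

Lemma fglift1 (K : choiceType) (V : lmodType R) (f : K -> V) x :
  fglift f << x >> = f x.
Proof. by rewrite liftU scale1r. Qed.

Lemma freeg_linear_ext (K : choiceType) (V : lmodType R)
    (f g : {linear {freeg K / R} -> V}) :
  (forall x, f << x >> = g << x >>) -> forall D, f D = g D.
Proof.
move=> fg; elim/freeg_ind_dom0 => [|k c D _ _ IH]; first by rewrite !linear0.
rewrite !linearD IH; congr (_ + _).
suff -> : << k *g c >> = k *: << c >> :> {freeg K / R}.
  by rewrite !linearZ fg.
by apply/eqP/freeg_eqP=> z; rewrite coeffZ !coeffU mulrA mulr1.
Qed.

Lemma free_projective (K : choiceType) : projective_module {freeg K / R}.
Proof.
move=> A B p f psurj.
have [s sP] := choice (fun x : K => psurj (f << x >>)).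
exists (fglift s : {linear {freeg K / R} -> A}).
apply: (freeg_linear_ext (f := p \o fglift s)) => x /=.
by rewrite fglift1 sP.
Qed.

End FreeModule.

Section Kernel.
Variables (R : nzRingType) (A B : lmodType R) (f : {linear A -> B}).

Definition ker_pred : {pred A} := [pred x | f x == 0].

Lemma ker_submod : submod_closed ker_pred.
Proof.
split=> [|a x y]; rewrite !inE ?linear0 // => /eqP fx /eqP fy.
by rewrite linearP fx fy scaler0 addr0.
Qed.

HB.instance Definition _ := GRing.isSubmodClosed.Build R A ker_pred ker_submod.

Record kernel := Kernel { kernel_val :> A; _ : kernel_val \in ker_pred }.

HB.instance Definition _ := [isSub for kernel_val].
HB.instance Definition _ := [Choice of kernel by <:].
HB.instance Definition _ := [SubChoice_isSubLmodule of kernel by <:].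

Lemma kernelP (x : kernel) : f (val x) = 0.
Proof. by case: x => x /= /eqP. Qed.

End Kernel.

Section QuotientModule.
Variables (R : nzRingType) (V : lmodType R) (N0 : {pred V}).
Hypothesis N0_submod : submod_closed N0.

(* Carries the proof, so that closure instances can be attached to it. *)
Definition quotient_pred of submod_closed N0 : {pred V} := N0.
Local Notation N := (quotient_pred N0_submod).
HB.instance Definition _ := GRing.isSubmodClosed.Build R V N N0_submod.

Definition quotient_module := Quotient.quot N.
HB.instance Definition _ := GRing.Zmodule.on quotient_module.

Definition quotient_class (x : V) : quotient_module := \pi_(Quotient.quot N) x.
Definition quotient_scale (a : R) (q : quotient_module) : quotient_module :=
  quotient_class (a *: repr q).

Lemma quotient_classE x y :
  (quotient_class x == quotient_class y) = (x - y \in N0).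
Proof. by rewrite -[RHS]/(x - y \in N) Quotient.idealrBE. Qed.

Lemma quotient_classK (q : quotient_module) : quotient_class (repr q) = q.
Proof. exact: reprK. Qed.

Lemma quotient_class_add x y :
  quotient_class (x + y) = quotient_class x + quotient_class y.
Proof. exact: (Quotient.pi_add N). Qed.

Lemma quotient_class_scale a x :
  quotient_class (a *: x) = quotient_scale a (quotient_class x).
Proof.
apply/eqP; rewrite quotient_classE -scalerBr; apply: (rpredZ _ (s := N)).
by rewrite -quotient_classE quotient_classK.
Qed.

Fact quotient_scaleA a b q :
  quotient_scale a (quotient_scale b q) = quotient_scale (a * b) q.
Proof.
by rewrite -[q]quotient_classK -!quotient_class_scale scalerA.
Qed.

Fact quotient_scale1 : left_id 1 quotient_scale.
Proof.
by move=> q; rewrite -[q]quotient_classK -!quotient_class_scale scale1r.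
Qed.

Fact quotient_scaleDr : right_distributive quotient_scale +%R.
Proof.
move=> a p q; rewrite -[p]quotient_classK -[q]quotient_classK.
by rewrite -!(quotient_class_scale, quotient_class_add) scalerDr.
Qed.

Fact quotient_scaleDl q :
  {morph quotient_scale^~ q : a b / a + b}.
Proof.
move=> a b; rewrite -[q]quotient_classK.
by rewrite -!(quotient_class_scale, quotient_class_add) scalerDl.
Qed.

HB.instance Definition _ :=
  GRing.Zmodule_isLmodule.Build R quotient_module
    quotient_scaleA quotient_scale1 quotient_scaleDr quotient_scaleDl.

Fact quotient_class_linear : linear quotient_class.
Proof. by move=> a x y; rewrite quotient_class_add quotient_class_scale. Qed.

HB.instance Definition _ :=
  GRing.isLinear.Build R V quotient_module _ quotient_class
    quotient_class_linear.

End QuotientModule.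

Section TensorProduct.
Variables (R : nzRingType) (A : lmodType R^c) (F : lmodType R).

Local Notation Z := {freeg (A * F)%type / int}.

Definition tensor_relator (r : Z) : Prop :=
  [\/ exists a a' x, r = << (a + a', x) >> - << (a, x) >> - << (a', x) >>,
      exists a x x', r = << (a, x + x') >> - << (a, x) >> - << (a, x') >> |
      exists a (c : R) x, r = << ((c : R^c) *: a, x) >> - << (a, c *: x) >>].

Definition tensor_rel : {pred Z} := fun t =>
  `[< forall N : {pred Z}, zmod_closed N ->
        (forall r, tensor_relator r -> r \in N) -> t \in N >].

Lemma tensor_rel_closed : zmod_closed tensor_rel.
Proof.
split; first by apply/asboolP => N [].
move=> x y /asboolP Nx /asboolP Ny; apply/asboolP => N Nz Nr.
by apply: Nz.2; [exact: Nx | exact: Ny].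
Qed.

HB.instance Definition _ := GRing.isZmodClosed.Build Z tensor_rel
  tensor_rel_closed.

Definition tensor := Quotient.quot tensor_rel.
HB.instance Definition _ := GRing.Zmodule.on tensor.

Definition tensor_class (t : Z) : tensor := \pi_(Quotient.quot tensor_rel) t.
Definition pure_tensor (a : A) (x : F) : tensor := tensor_class << (a, x) >>.

End TensorProduct.

Arguments tensor_rel {R} A F.

Section TensorMap.
Variables (R : nzRingType) (A B : lmodType R^c) (F : lmodType R).
Variable f : {linear A -> B}.

Definition pre_tensor_map :
    {freeg (A * F)%type / int} -> {freeg (B * F)%type / int} :=
  fglift (fun ax => << (f ax.1, ax.2) >>).

Lemma pre_tensor_mapB u v :
  pre_tensor_map (u - v) = pre_tensor_map u - pre_tensor_map v.
Proof. exact: linearB. Qed.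

Lemma pre_tensor_mapU a x : pre_tensor_map << (a, x) >> = << (f a, x) >>.
Proof. exact: fglift1. Qed.

(* f (x) id_F : A (x)_R F -> B (x)_R F *)
Definition tensor_map (t : tensor A F) : tensor B F :=
  tensor_class (pre_tensor_map (repr t)).

Lemma tensor_map_class t :
  tensor_map (tensor_class t) = tensor_class (pre_tensor_map t).
Proof.
pose N : {pred {freeg (A * F)%type / int}} :=
  fun u => pre_tensor_map u \in tensor_rel B F.
have Nz : zmod_closed N.
  split=> [|u v]; rewrite ![_ \in N]unfold_in.
    by rewrite -(subrr 0) pre_tensor_mapB subrr rpred0.
  by rewrite pre_tensor_mapB; exact: rpredB.
have Nr r : tensor_relator r -> r \in N.
  move=> rr; rewrite [_ \in N]unfold_in; apply/asboolP => S _; apply.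
  case: rr => [[a [a' [x ->]]]|[a [x [x' ->]]]|[a [c [x ->]]]].
  - apply: Or31; exists (f a), (f a'), x.
    by rewrite !(pre_tensor_mapB, pre_tensor_mapU) linearD.
  - apply: Or32; exists (f a), x, x'.
    by rewrite !(pre_tensor_mapB, pre_tensor_mapU).
  - apply: Or33; exists (f a), c, x.
    by rewrite !(pre_tensor_mapB, pre_tensor_mapU) linearZ.
apply/eqP; rewrite /tensor_map /tensor_class -Quotient.idealrBE.
rewrite -pre_tensor_mapB.
have : repr (tensor_class t) - t \in tensor_rel A F.
  by rewrite Quotient.idealrBE reprK.
by move/asboolP => /(_ N Nz Nr).
Qed.

Lemma tensor_map_pure a x :
  tensor_map (pure_tensor a x) = pure_tensor (f a) x.
Proof. by rewrite /pure_tensor tensor_map_class pre_tensor_mapU. Qed.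

End TensorMap.

Section FlatDimension.
Variable R : nzRingType.

Definition flat_module (F : lmodType R) : Prop :=
  forall (A B : lmodType R^c) (f : {linear A -> B}),
    injective f -> injective (@tensor_map R A B F f).

Definition flat_dim_le (M : lmodType R) (n : nat) : Prop :=
  exists F : resolution M,
    (forall k, flat_module (F k)) /\
    (forall k, (n < k)%N -> zero_module (F k)).

Definition left_quasi_infty_Gorenstein : Prop :=
  exists I : coresolution (R^o : lmodType R),
    minimal_injective_resolution I /\
    forall i, flat_dim_le (I i) i.+1.

End FlatDimension.

(* Hom_R(M, R) for a left R-module M, as a right module: (f a) x = (f x) a,
   which is the scalar multiplication of the right module R_R, that is
   [R^c^o], applied pointwise. *)
Section Dual.
Variables (R : nzRingType) (M : lmodType R).

Definition dual_pred : {pred M -> R^c^o} :=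
  fun phi => `[< linear (phi : M -> R^o) >].

Lemma dual_submod : submod_closed dual_pred.
Proof.
split=> [|a phi psi /asboolP phiL /asboolP psiL]; apply/asboolP.
  by move=> c x y; rewrite -[LHS]/(0 : R) scaler0 addr0.
move=> c x y; rewrite -![(a *: phi + psi) _]/((phi _ : R) * a + psi _).
rewrite phiL psiL -![c *: (_ : R^o)]/(c * _ : R).
by rewrite !mulrDl mulrDr !mulrA addrACA.
Qed.

HB.instance Definition _ :=
  GRing.isSubmodClosed.Build R^c (M -> R^c^o) dual_pred dual_submod.

Record dual := Dual { dual_fun :> M -> R^c^o; _ : dual_fun \in dual_pred }.

HB.instance Definition _ := [isSub for dual_fun].
HB.instance Definition _ := [Choice of dual by <:].
HB.instance Definition _ := [SubChoice_isSubLmodule of dual by <:].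

Lemma dual_linear (phi : dual) : linear (phi : M -> R^o).
Proof. by case: phi => phi /= /asboolP. Qed.

End Dual.

Arguments dual_pred {R} M.

Section DualMap.
Variables (R : nzRingType) (A B : lmodType R) (f : {linear A -> B}).

Lemma dual_map_subproof (phi : dual B) :
  ((phi : B -> R^c^o) \o f) \in dual_pred A.
Proof.
by apply/asboolP => a x y; rewrite /= linearP dual_linear.
Qed.

Definition dual_fun_map (phi : dual B) : dual A := Dual (dual_map_subproof phi).

Lemma dual_map_linear : linear dual_fun_map.
Proof. by move=> a phi psi; apply: val_inj. Qed.

HB.instance Definition _ :=
  GRing.isLinear.Build R^c (dual B) (dual A) _ dual_fun_map dual_map_linear.

Definition dual_map : {linear dual B -> dual A} := dual_fun_map.

End DualMap.

(* ker g / im f; when g \o f <> 0 the image is cut down to ker g. *)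
Section Homology.
Variables (R : nzRingType) (A B C : lmodType R).
Variables (f : {linear A -> B}) (g : {linear B -> C}).

Definition boundary_pred : {pred kernel g} :=
  fun z => `[< exists a, f a = val z >].

Lemma boundary_submod : submod_closed boundary_pred.
Proof.
split=> [|c x y /asboolP[a fa] /asboolP[b fb]]; apply/asboolP.
  by exists 0; rewrite linear0.
by exists (c *: a + b); rewrite linearP fa fb.
Qed.

HB.instance Definition _ :=
  GRing.isSubmodClosed.Build R (kernel g) boundary_pred boundary_submod.

Definition homology : lmodType R := quotient_module boundary_submod.

End Homology.

Section CanonicalFreeResolution.
Variables (R : nzRingType) (M : lmodType R).

Definition free_cover (V : lmodType R) : {linear {freeg V / R} -> V} :=
  fglift (id : V -> V).

Fixpoint syzygy (n : nat) : lmodType R :=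
  if n is n'.+1 then kernel (free_cover (syzygy n')) else M.

Definition free_res_obj (n : nat) : lmodType R := {freeg (syzygy n) / R}.

Definition free_res_d (n : nat) :
    {linear free_res_obj n.+1 -> free_res_obj n} :=
  (val : kernel (free_cover (syzygy n)) -> free_res_obj n)
    \o free_cover (syzygy n.+1).

Lemma free_cover_surj (V : lmodType R) (x : V) : exists D, free_cover V D = x.
Proof. by exists << x >>; exact: fglift1. Qed.

Lemma free_cover_exact n x :
  free_cover (syzygy n) x = 0 <-> exists y, free_res_d n y = x.
Proof.
split=> [x0|[y <-]]; last exact: kernelP.
have xP : x \in ker_pred (free_cover (syzygy n)) by rewrite inE x0.
have [y yP] := free_cover_surj (Kernel xP : syzygy n.+1).
by exists y; rewrite /free_res_d /= yP.
Qed.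

Lemma free_res_exact n x :
  free_res_d n x = 0 <-> exists y, free_res_d n.+1 y = x.
Proof.
rewrite -free_cover_exact; split=> [dx|fx]; last by rewrite /free_res_d /= fx.
exact: val_inj.
Qed.

Definition free_resolution : resolution M :=
  @Resolution R M free_res_obj free_res_d (free_cover M)
    (@free_cover_surj M) (@free_cover_exact 0) free_res_exact.

Lemma free_resolution_projective : projective_resolution free_resolution.
Proof. by move=> n; apply: free_projective. Qed.

End CanonicalFreeResolution.

(* The cohomology of Hom_R(P, R), in degree n, for a resolution P. *)
Definition ext_of (R : nzRingType) (M : lmodType R) (P : resolution M)
    (n : nat) : lmodType R^c :=
  if n is n'.+1 then homology (dual_map (res_d P n')) (dual_map (res_d P n'.+1))
  else kernel (dual_map (res_d P 0)).

Lemma ext0_hom (R : nzRingType) (M : lmodType R) (P : resolution M)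
    (phi : dual (P 0%N)) :
  phi \in ker_pred (dual_map (res_d P 0)) <->
  exists! psi : dual M, dual_map (res_aug P) psi = phi.
Proof.
have lin (V : lmodType R) (q : dual V) (x y : V) :
    q (x - y) = q x - q y :> R.
  have := dual_linear q (-1) y x; rewrite scaleN1r [- y + x]addrC => ->.
  by rewrite -[(-1) *: _]/((-1 : R) * q y) mulN1r addrC.
split=> [/eqP phi0|[psi [<- _]]]; last first.
  apply/eqP/val_inj/funext => x /=.
  have -> : res_aug P (res_d P 0 x) = 0 by apply/res_exact0; exists x.
  by have := lin _ psi 0 0; rewrite !subrr.
have phid y : phi (res_d P 0 y) = 0 :> R.
  by have /(congr1 (fun q : dual _ => q y)) := phi0.
have phiE x y : res_aug P x = res_aug P y -> phi x = phi y.
  move=> xy; apply/eqP; rewrite -subr_eq0 -(lin _ phi).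
  have [|z <-] := (res_exact0 (x - y)).1; first by rewrite linearB xy subrr.
  by rewrite phid.
have [s sP] := choice (@res_aug_surj R M P).
have psiP : (fun m => phi (s m)) \in dual_pred M.
  apply/asboolP => a x y; rewrite -dual_linear; apply: phiE.
  by rewrite linearP !sP.
exists (Dual psiP); split.
  by apply/val_inj/funext => x /=; apply: phiE; rewrite sP.
move=> psi psiE; apply/val_inj/funext => m /=.
by rewrite -[phi]psiE /= sP.
Qed.

(* Ext_R^n(M, R) of a left R-module M, as a right R-module. *)
Definition ext (R : nzRingType) (n : nat) (M : lmodType R) : lmodType R^c :=
  ext_of (free_resolution M) n.

(* [R^c^c] has the same carrier and multiplication as [R], but is not
   convertible to it as a ring. *)
Section ConverseInvolution.
Variables (R : nzRingType) (V : lmodType R^c^c).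

Definition unconverse : Type := V.
HB.instance Definition _ := GRing.Zmodule.on unconverse.

Definition unconverse_scale (a : R) (x : unconverse) : unconverse :=
  (a : R^c^c) *: (x : V).

Fact unconverse_scaleA a b x :
  unconverse_scale a (unconverse_scale b x) = unconverse_scale (a * b) x.
Proof. exact: scalerA. Qed.
Fact unconverse_scale1 : left_id 1 unconverse_scale.
Proof. exact: scale1r. Qed.
Fact unconverse_scaleDr : right_distributive unconverse_scale +%R.
Proof. move=> a x y; exact: (@scalerDr R^c^c V). Qed.
Fact unconverse_scaleDl x : {morph unconverse_scale^~ x : a b / a + b}.
Proof. move=> a b; exact: (@scalerDl R^c^c V). Qed.

HB.instance Definition _ :=
  GRing.Zmodule_isLmodule.Build R unconverse
    unconverse_scaleA unconverse_scale1 unconverse_scaleDr unconverse_scaleDl.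

End ConverseInvolution.

(* Ext_{R^op}^n(N, R) of a right R-module N, as a left R-module. *)
Definition ext_op (R : nzRingType) (n : nat) (N : lmodType R^c) :
    lmodType R :=
  unconverse (ext n N).

Definition grade_ge (R : nzRingType) (M : lmodType R) (g : nat) : Prop :=
  forall j, (j < g)%N -> zero_module (ext j M).

(* grade M is finite and equal to g *)
Definition has_grade (R : nzRingType) (M : lmodType R) (g : nat) : Prop :=
  grade_ge M g /\ ~ zero_module (ext g M).

(* Main.v *)
Require Import Defs.
From HB Require Import structures.
From mathcomp Require Import all_boot all_order all_algebra.
From mathcomp Require Import boolp functions.
From mathcomp.multinomials Require Import freeg.

(* Let 0 -> R -> I_0 -> I_1 -> ... be the minimal injective resolution and
   N = Ext^g(M, R). Dualizing a finite free resolution of M up to degree g + 1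
   and reversing it gives a complex E that is exact except at N, because
   grade M = g. The cone of a chain map Phi from a finite free resolution Q of
   N to E is a free resolution of a right module D, and for i <> g it exhibits
   Ext^i(N, R) as a submodule of Ext^(i+2)(D, R). As I_l has flat dimension at
   most l + 1, Hom(Ext^(i+2)(D, R), I_l) = Tor_(i+2)(D, I_l) = 0 for l <= i, so
   Hom(Ext^i(N, R), I_l) = 0 and Ext^i(Ext^i(N, R), R) = 0.
   If Ext^g(Ext^g(N, R), R) vanished too, any element of Q_0 could be pushed
   along the double complex of Q and I up to degree g and, through Phi, back
   down along E, showing that its class in N is zero; but N <> 0. *)

Set Implicit Arguments.
Unset Strict Implicit.
Unset Printing Implicit Defensive.

Import GRing.Theory.
Local Open Scope ring_scope.

(** [E] stops at the dual of P_(g+1), P being the resolution of M, so D is the cokernel of P_g^* ->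
    P_(g+1)^*. In the cone Q_i sits in degree i + 2, and the long exact sequence contains
    H^(i+1)(Hom(E, R)) -> Ext^i(N, R) -> Ext^(i+2)(D, R). In positive degrees the dual of [E] is P
    again, whose only homology is M at P_0, that is in degree g + 1: this excludes exactly i = g.
    The bound l + 1 <= i + 1 lies just below the degree i + 2 of the Tor. The identity Hom(Ext^n(D,
    R), I) = Tor_n(D, I) for injective I is never stated as an isomorphism. A finite family y in I
    is at once a column of the complex tensored with I, on which matrices operate by [act], and the
    map [rdot y] from row vectors to I; a cycle is a map that kills coboundaries, and a boundary
    kills cocycles. *)

Section LinearBuild.
Variables (R : nzRingType) (A B : lmodType R) (f : A -> B).
Hypothesis f_linear : linear f.

(* Carries the proof, so that the linear structure can be attached to it. *)
Definition linear_fun : A -> B := let _ := f_linear in f.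
HB.instance Definition _ :=
  GRing.isLinear.Build R A B _ linear_fun f_linear.
Definition linear_of : {linear A -> B} := linear_fun.

End LinearBuild.

Section Choice.
Variables (A : nat -> Type) (good : forall n, A n -> Prop).
Variable rel : forall n, A n -> A n.+1 -> Prop.

(** The type [A n] may change with n, as it does for the components of a chain map; [good] is the
    invariant that makes the next step possible. *)
Lemma dependent_choice (a0 : A 0) : good a0 ->
  (forall n (a : A n), good a -> exists b, good b /\ rel a b) ->
  exists f : forall n, A n,
    f 0%N = a0 /\ forall n, good (f n) /\ rel (f n) (f n.+1).
Proof.
move=> good0 step.
have next n (a : {a : A n | good a}) :
    {b : {b : A n.+1 | good b} | rel (sval a) (sval b)}.
  case: a => a ga /=; have /cid[b [gb ab]] := step n a ga.
  by exists (exist _ b gb).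
pose F := fix F n : {a : A n | good a} :=
  if n is n'.+1 then sval (next n' (F n')) else exist _ a0 good0.
exists (fun n => sval (F n)); split=> // n; split; first exact: svalP (F n).
exact: svalP (next n (F n)).
Qed.

End Choice.

Section QuotientLift.
Variables (R : nzRingType) (A C : lmodType R) (N : {pred A}).
Hypothesis N_submod : submod_closed N.
Variables (f : {linear A -> C}) (fN : forall x, x \in N -> f x = 0).

Let lift_fun (q : quotient_module N_submod) : C := f (repr q).

Let lift_funE x : lift_fun (quotient_class N_submod x) = f x.
Proof.
apply/eqP; rewrite -subr_eq0 -linearB; apply/eqP/fN.
by rewrite -(quotient_classE N_submod) quotient_classK.
Qed.

Let lift_linear : linear lift_fun.
Proof.
move=> a p q; rewrite -[p]quotient_classK -[q]quotient_classK -linearP.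
by rewrite !lift_funE linearP.
Qed.

Lemma quotient_lift : exists h : {linear quotient_module N_submod -> C},
  (forall x, h (quotient_class N_submod x) = f x) /\
  (forall q, h q = f (repr q)).
Proof. by exists (linear_of lift_linear). Qed.

End QuotientLift.

(** * Extension and lifting along arbitrary linear maps *)

Section Factorization.
Variable R : nzRingType.

Lemma coimage_embedding (A B : lmodType R) (d : {linear A -> B}) :
  exists h : {linear quotient_module (ker_submod d) -> B},
    injective h /\ forall x, h (quotient_class (ker_submod d) x) = d x.
Proof.
have [|h [hE hrepr]] := @quotient_lift R A B _ (ker_submod d) d.
  by move=> x /eqP.
exists h; split=> // p q; rewrite !hrepr => pq.
rewrite -[p]quotient_classK -[q]quotient_classK; apply/eqP.
by rewrite quotient_classE inE linearB pq subrr.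
Qed.

(** Injectivity for a [d] with a kernel: A / ker d embeds in B, and [f] descends to it. *)
Lemma injective_extension (A B I : lmodType R) (d : {linear A -> B})
    (f : {linear A -> I}) :
  injective_module I -> (forall x, d x = 0 -> f x = 0) ->
  exists g : {linear B -> I}, forall x, g (d x) = f x.
Proof.
move=> Iinj fd.
have [h [hinj hE]] := coimage_embedding d.
have [|k [kE _]] := @quotient_lift R A I _ (ker_submod d) f.
  by move=> x /eqP; exact: fd.
have [g gE] := Iinj _ _ h k hinj.
by exists g => x; rewrite -hE gE kE.
Qed.

(** Projectivity for a [d] that need not be onto. The kernel of [delta] is the pullback of [d] and
    [f]; it projects onto P, and a section of this projection contains the lift. *)
Lemma projective_lift (P A B : lmodType R) (d : {linear A -> B})
    (f : {linear P -> B}) :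
  projective_module P -> (forall x, exists a, d a = f x) ->
  exists g : {linear P -> A}, forall x, d (g x) = f x.
Proof.
move=> Pproj fd.
have lin_delta : linear (fun ax : (A * P)%type => d ax.1 - f ax.2).
  by move=> c x y /=; rewrite !linearP scalerDr addrACA.
pose delta := linear_of lin_delta.
have lin_p : linear (fun k : kernel delta => (val k).2) by move=> c x y.
have lin_q : linear (fun k : kernel delta => (val k).1) by move=> c x y.
have [x|g gE] := Pproj _ P (linear_of lin_p) idfun.
  have [a ax] := fd x.
  have axP : (a, x) \in ker_pred delta.
    by rewrite inE /= /linear_fun /= ax subrr.
  by exists (Kernel axP).
exists (linear_of lin_q \o g) => x /=.
have := kernelP (g x); rewrite /= /linear_fun => /eqP.
rewrite subr_eq0 => /eqP ->.
by have := gE x; rewrite /= /linear_fun => ->.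
Qed.

End Factorization.

Section Augmentation.
Variables (R : nzRingType) (M : lmodType R).

(* ... -> P 1 -> P 0 -> M and M -> I 0 -> I 1 -> ... as single complexes with
   [M] in degree 0. *)
Definition aug_obj (P : resolution M) (n : nat) : lmodType R :=
  if n is n'.+1 then P n' else M.

Definition aug_d (P : resolution M) (n : nat) :
    {linear aug_obj P n.+1 -> aug_obj P n} :=
  if n is n'.+1 then res_d P n' else res_aug P.

Lemma aug_d_surj (P : resolution M) (x : aug_obj P 0) :
  exists y, aug_d P 0 y = x.
Proof. exact: res_aug_surj. Qed.

Lemma aug_d_exact (P : resolution M) n x :
  aug_d P n x = 0 <-> exists y, aug_d P n.+1 y = x.
Proof. by case: n x => [|n] x; [exact: res_exact0 | exact: res_exactS]. Qed.

Lemma aug_dd (P : resolution M) n x : aug_d P n (aug_d P n.+1 x) = 0.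
Proof. by apply/aug_d_exact; exists x. Qed.

Definition coaug_obj (I : coresolution M) (n : nat) : lmodType R :=
  if n is n'.+1 then I n' else M.

Definition coaug_d (I : coresolution M) (n : nat) :
    {linear coaug_obj I n -> coaug_obj I n.+1} :=
  if n is n'.+1 then cores_d I n' else cores_aug I.

Lemma coaug_d_inj (I : coresolution M) : injective (coaug_d I 0).
Proof. exact: cores_aug_inj. Qed.

Lemma coaug_d_exact (I : coresolution M) n x :
  coaug_d I n.+1 x = 0 <-> exists y, coaug_d I n y = x.
Proof. by case: n x => [|n] x; [exact: cores_exact0 | exact: cores_exactS]. Qed.

Lemma coaug_dd (I : coresolution M) n x : coaug_d I n.+1 (coaug_d I n x) = 0.
Proof. by apply/coaug_d_exact; exists x. Qed.

End Augmentation.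

(** * Independence of Ext from the projective resolution *)

Section ExtClass.
Variables (R : nzRingType) (V : lmodType R) (P : resolution V).

Definition cocycle n : lmodType R^c := kernel (dual_map (res_d P n)).

Definition coboundary n : dual (P n) -> Prop :=
  match n with
  | 0 => fun phi => phi = 0
  | n'.+1 => fun phi => exists psi, dual_map (res_d P n') psi = phi
  end.

Lemma coboundaryB n phi psi :
  @coboundary n phi -> coboundary psi -> coboundary (phi - psi).
Proof.
case: n phi psi => [|n] phi psi /=; first by move=> -> ->; rewrite subr0.
by move=> [a <-] [b <-]; exists (a - b); rewrite linearB.
Qed.

(** Hides the case distinction in [ext_of] (a kernel in degree 0, a homology module above): later
    arguments handle classes only through cocycles and the test for vanishing. *)
Lemma ext_class n : exists cls : {linear cocycle n -> ext_of P n},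
  (forall e, exists z, cls z = e) /\
  forall z, cls z = 0 <-> coboundary (val z).
Proof.
case: n => [|n].
  exists idfun; split=> [e|z /=]; first by exists e.
  by split=> [->|z0] //; apply: val_inj.
pose N := boundary_submod (dual_map (res_d P n)) (dual_map (res_d P n.+1)).
exists (quotient_class N : {linear _ -> _}); split=> [e|z].
  by exists (repr e); exact: quotient_classK.
have := quotient_classE N z 0.
have -> : quotient_class N 0 = 0 by exact: (linear0 (quotient_class N)).
rewrite subr0 => zE; split=> [/eqP|zB]; last first.
  by apply/eqP; rewrite zE; apply/asboolP.
by rewrite zE => /asboolP.
Qed.

Lemma ext_of_zero n : zero_module (ext_of P n) <->
  forall phi, dual_map (res_d P n) phi = 0 -> coboundary phi.
Proof.
have [cls [cls_surj cls0]] := ext_class n.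
split=> [ext0 phi /eqP phiP|cob e].
  have phiK : phi \in ker_pred (dual_map (res_d P n)) by rewrite inE.
  by have /cls0 := ext0 (cls (Kernel phiK)).
by have [z <-] := cls_surj e; apply/cls0/cob; exact: (kernelP z).
Qed.

End ExtClass.

Section Comparison.
Variable R : nzRingType.

Definition chain_map (V : lmodType R) (P Q : resolution V)
    (t : forall n, {linear P n -> Q n}) : Prop :=
  forall n x, res_d Q n (t n.+1 x) = t n (res_d P n x).

Lemma comparison_map (V : lmodType R) (P Q : resolution V) :
  projective_resolution P ->
  exists t : forall n, {linear P n -> Q n},
    (forall x, res_aug Q (t 0%N x) = res_aug P x) /\ chain_map t.
Proof.
move=> Pproj.
pose good n (t : {linear P n -> Q n}) :=
  forall x, aug_d P n x = 0 -> aug_d Q n (t x) = 0.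
pose rel n (t : {linear P n -> Q n}) (t' : {linear P n.+1 -> Q n.+1}) :=
  forall x, res_d Q n (t' x) = t (res_d P n x).
have [t0 t0E] := projective_lift (f := res_aug P) (Pproj 0%N)
  (fun x => @res_aug_surj R V Q _).
have [|n t tgood|t [t0_eq tP]] :=
  @dependent_choice (fun n => {linear P n -> Q n}) good rel t0.
- by move=> x x0; rewrite t0E.
- have [x|t' t'E] := @projective_lift R (P n.+1) (Q n.+1) (Q n)
    (res_d Q n) (t \o res_d P n) (Pproj n.+1).
    by apply/(aug_d_exact (P := Q) (n := n))/tgood; apply: (@aug_dd R V P n).
  exists t'; split=> // x x0; rewrite /aug_d t'E /=.
  by rewrite -/(aug_d P n.+1 x) in x0; rewrite (x0 : res_d P n x = 0) linear0.
by exists t; split=> [x|n x]; [rewrite t0_eq t0E | case: (tP n) => _ ->].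
Qed.

(** A null homotopy, one degree at a time: [r] is its component in degree n and [s] the one in
    degree n - 1, which starts from V and is zero when n = 0. Each [r] becomes the next [s]. *)
Lemma null_chain_map (V : lmodType R) (P : resolution V)
    (u : forall n, {linear P n -> P n}) :
  projective_resolution P ->
  (forall x, res_aug P (u 0%N x) = 0) -> chain_map u ->
  forall n, exists (r : {linear P n -> P n.+1})
    (s : {linear aug_obj P n -> P n}),
    (n = 0%N -> forall x, s x = 0) /\
    forall x, u n x = res_d P n (r x) + s (aug_d P n x).
Proof.
move=> Pproj u0 uc; elim=> [|n [r [s [_ rs]]]].
  have [x|r rE] := @projective_lift R _ _ _ (res_d P 0) (u 0%N) (Pproj 0%N).
    exact/res_exact0.
  by exists r, \0 => /=; split=> // x; rewrite rE addr0.
have [x|r' r'E] := @projective_lift R _ _ _ (res_d P n.+1)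
    (u n.+1 \- (r \o res_d P n)) (Pproj n.+1).
  apply/res_exactS => /=.
  rewrite linearB /= uc rs (aug_dd (P := P) (n := n)) linear0 addr0.
  exact: subrr.
by exists r', r; split=> // x; rewrite r'E /= subrK.
Qed.

(** In u = d r + s d the first term dies under the cocycle [phi], which leaves the coboundary of
    [phi] composed with [s]. *)
Lemma null_chain_map_coboundary (V : lmodType R) (P : resolution V)
    (u : forall n, {linear P n -> P n}) :
  projective_resolution P ->
  (forall x, res_aug P (u 0%N x) = 0) -> chain_map u ->
  forall n (phi : dual (P n)), dual_map (res_d P n) phi = 0 ->
  coboundary (dual_map (u n) phi).
Proof.
move=> Pproj u0 uc n phi phi0.
have phid x : phi (res_d P n x) = 0.
  by have /(congr1 (fun f : dual _ => f x)) := phi0.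
have [r [s [s0 rs]]] := null_chain_map Pproj u0 uc n.
have uE x : dual_map (u n) phi x = phi (s (aug_d P n x)).
  rewrite /= rs -[res_d P n (r x)]scale1r.
  have /= -> := dual_linear phi 1 (res_d P n (r x)) (s (aug_d P n x)).
  by rewrite phid scaler0 add0r.
case: n r s rs s0 phi phi0 phid uE => [|n] r s _ s0 phi _ phid uE /=.
  apply/val_inj/funext => x; rewrite [LHS]uE s0 //.
  by rewrite -(linear0 (res_d P 0)) phid.
by exists (dual_map s phi); apply/val_inj/funext => x; rewrite [RHS]uE.
Qed.

Lemma dual_mapB (A B : lmodType R) (f g h : {linear A -> B}) :
  (forall x, h x = f x - g x) ->
  forall phi, dual_map h phi = dual_map f phi - dual_map g phi.
Proof.
move=> hE phi; apply/val_inj/funext => x /=.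
have -> : h x = (-1) *: g x + f x by rewrite hE scaleN1r addrC.
have := dual_linear phi (-1) (g x) (f x); rewrite /= => ->.
by rewrite scaleN1r addrC.
Qed.

(** Comparison maps both ways are inverse up to homotopy, since the identity minus their composite
    lifts zero. The result is a surjection from cocycles, so that a class of [Q] can be named by a
    cocycle of [P]. *)
Theorem ext_of_comparison (V : lmodType R) (P Q : resolution V) :
  projective_resolution P -> projective_resolution Q ->
  forall n, exists cls : {linear cocycle P n -> ext_of Q n},
    (forall e, exists z, cls z = e) /\
    forall z, cls z = 0 <-> coboundary (val z).
Proof.
move=> Pproj Qproj n.
have [t [t0 tc]] := comparison_map P Qproj.
have [s [s0 sc]] := comparison_map Q Pproj.
have [cls [cls_surj cls0]] := ext_class Q n.
have cobt (A B : resolution V) (w : forall n, {linear A n -> B n}) :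
    chain_map w ->
    forall phi, coboundary phi -> coboundary (dual_map (w n) phi).
  case: (n) => [|m] wc phi /=; first by move=> ->; rewrite linear0.
  move=> [psi <-]; exists (dual_map (w m) psi).
  by apply/val_inj/funext => x /=; rewrite wc.
have cyct (A B : resolution V) (w : forall n, {linear A n -> B n}) phi :
    chain_map w -> dual_map (res_d B n) phi = 0 ->
    dual_map (res_d A n) (dual_map (w n) phi) = 0.
  move=> wc phi0; rewrite -(linear0 (dual_map (w n.+1))) -phi0.
  by apply/val_inj/funext => x /=; rewrite wc.
have cobst (A B : resolution V) (w : forall n, {linear A n -> B n})
    (v : forall n, {linear B n -> A n}) :
    projective_resolution A -> chain_map w -> chain_map v ->
    (forall x, res_aug B (w 0%N x) = res_aug A x) ->
    (forall x, res_aug A (v 0%N x) = res_aug B x) ->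
    forall phi, dual_map (res_d A n) phi = 0 ->
    coboundary (phi - dual_map (w n) (dual_map (v n) phi)).
  move=> Aproj wc vc w0 v0 phi phi0.
  pose u n : {linear A n -> A n} := idfun \- (v n \o w n).
  have -> : phi - dual_map (w n) (dual_map (v n) phi) = dual_map (u n) phi.
    rewrite (@dual_mapB _ _ idfun (v n \o w n)) //.
    by congr (_ - _); apply: val_inj.
  apply: null_chain_map_coboundary => // [x|m x] /=.
    by rewrite linearB /= v0 w0 subrr.
  by rewrite linearB /= vc wc.
have tK (z : cocycle P n) :
    dual_map (t n) (val z) \in ker_pred (dual_map (res_d Q n)).
  by rewrite inE cyct //; exact: (kernelP z).
have tlin : linear (fun z : cocycle P n => Kernel (tK z) : cocycle Q n).
  by move=> a x y; apply: val_inj; rewrite /= linearP.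
exists (cls \o linear_of tlin); split=> [e|z] /=.
  have [z <-] := cls_surj e.
  have sK : dual_map (s n) (val z) \in ker_pred (dual_map (res_d P n)).
    by rewrite inE cyct //; exact: (kernelP z).
  exists (Kernel sK); apply/eqP; rewrite -subr_eq0 -linearB; apply/eqP/cls0.
  rewrite -opprB -[- _]sub0r linearB /=.
  apply: coboundaryB; first by case: (n) => //= m; exists 0; rewrite linear0.
  by apply: cobst => //; exact: (kernelP z).
rewrite cls0 /=; split=> [zB|]; last exact: cobt.
rewrite -[val z](subrK (dual_map (s n) (dual_map (t n) (val z)))).
rewrite -[X in _ + X]opprK; apply: coboundaryB.
  by apply: cobst => //; exact: (kernelP z).
rewrite -sub0r; apply: coboundaryB; last exact: cobt.
by case: (n) => //= m; exists 0; rewrite linear0.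
Qed.

End Comparison.

(** * Ext through an injective coresolution *)

Section Balance.
Variables (R : nzRingType) (X W : lmodType R).
Variables (P : resolution X) (I : coresolution W).
Hypotheses (Pproj : projective_resolution P)
           (Iinj : forall n, injective_module (I n)).

(* With [Z_l] the cycles of [I] and [K_k] the cokernel of [res_d P k], these say
   H^(k+1)(Hom(P, Z_l)) = 0 and H^(l+1)(Hom(K_k, I)) = 0; they are equivalent
   along antidiagonals. *)
Let row_exact k l := forall f : {linear P k.+1 -> I l},
  (forall x, cores_d I l (f x) = 0) -> (forall x, f (res_d P k.+1 x) = 0) ->
  exists f' : {linear P k -> I l},
    (forall x, cores_d I l (f' x) = 0) /\ forall x, f x = f' (res_d P k x).

Let col_exact k l := forall f : {linear P k -> I l.+1},
  (forall x, cores_d I l.+1 (f x) = 0) -> (forall x, f (res_d P k x) = 0) ->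
  exists h : {linear P k -> I l},
    (forall x, h (res_d P k x) = 0) /\ forall x, f x = cores_d I l (h x).

Let lift_cycle k l (f : {linear P k -> I l.+1}) :
  (forall x, cores_d I l.+1 (f x) = 0) ->
  exists h : {linear P k -> I l}, forall x, cores_d I l (h x) = f x.
Proof.
by move=> df; apply: projective_lift => // x; apply/cores_exactS.
Qed.

Let extend_cocycle k l (f : {linear P k.+1 -> I l}) :
  (forall x, f (res_d P k.+1 x) = 0) ->
  exists h : {linear P k -> I l}, forall x, h (res_d P k x) = f x.
Proof.
move=> fd; apply: injective_extension => // x /res_exactS[y <-].
exact: fd.
Qed.

Let resdd k x : res_d P k (res_d P k.+1 x) = 0.
Proof. by apply/res_exactS; exists x. Qed.

Let coresdd k x : cores_d I k.+1 (cores_d I k x) = 0.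
Proof. by apply/cores_exactS; exists x. Qed.

(** A lift [h] of [f] through [cores_d I l] need not kill the image of [res_d P k]; the defect is a
    row datum, and subtracting its factorization [f'] repairs [h]. The converse is dual, with an
    extension in place of the lift. *)
Let row_col k l : row_exact k l <-> col_exact k l.
Proof.
split=> ex f df fd.
  have [h hE] := lift_cycle df.
  have [x|x|f' [df' f'E]] := ex (h \o res_d P k).
  - by rewrite /= hE fd.
  - by rewrite /= resdd linear0.
  exists (h \- f'); split=> x /=; last by rewrite linearB /= df' subr0 hE.
  by have /= -> := f'E x; exact: subrr.
have [h hE] := extend_cocycle fd.
have [x|x|h' [h'd h'E]] := ex (cores_d I l \o h).
- by rewrite /= coresdd.
- by rewrite /= hE df.
exists (h \- h'); split=> x /=; last by rewrite h'd subr0 hE.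
by rewrite linearB /=; have /= -> := h'E x; exact: subrr.
Qed.

Let col_row k l : col_exact k.+1 l <-> row_exact k l.+1.
Proof.
split=> ex f df fd.
  have [h [hd fE]] := ex f df fd; have [h' h'E] := extend_cocycle hd.
  by exists (cores_d I l \o h'); split=> x /=; rewrite ?coresdd // h'E fE.
have [f' [df' fE]] := ex f df fd; have [h' h'E] := lift_cycle df'.
by exists (h' \o res_d P k); split=> x /=; rewrite ?resdd ?linear0 // h'E fE.
Qed.

Let antidiagonal l k : row_exact k l <-> row_exact (k + l) 0.
Proof.
elim: l k => [|l IHl] k; first by rewrite addn0.
by rewrite -col_row -row_col addnS -addSn.
Qed.

(** Both sides say Ext^(k+1)(X, W) = 0. The left one is [row_exact k 0], the right one
    [col_exact 0 k], and the antidiagonal joins them. *)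
Lemma ext_balance k :
  (forall f : {linear P k.+1 -> W}, (forall x, f (res_d P k.+1 x) = 0) ->
    exists f' : {linear P k -> W}, forall x, f x = f' (res_d P k x)) <->
  (forall f : {linear X -> I k.+1}, (forall x, cores_d I k.+1 (f x) = 0) ->
    exists h : {linear X -> I k}, forall x, f x = cores_d I k (h x)).
Proof.
have factor0 (f : {linear P k -> I 0%N}) : (forall x, cores_d I 0 (f x) = 0) ->
    exists f' : {linear P k -> W}, forall x, cores_aug I (f' x) = f x.
  by move=> df; apply: projective_lift => // x; apply/cores_exact0.
have factor1 (f : {linear P k.+1 -> I 0%N}) :
    (forall x, cores_d I 0 (f x) = 0) ->
    exists f' : {linear P k.+1 -> W}, forall x, cores_aug I (f' x) = f x.
  by move=> df; apply: projective_lift => // x; apply/cores_exact0.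
have augd x : cores_d I 0 (cores_aug I x) = 0 by apply/cores_exact0; exists x.
have descend l (f : {linear P 0%N -> I l}) : (forall x, f (res_d P 0 x) = 0) ->
    exists f' : {linear X -> I l}, forall x, f' (res_aug P x) = f x.
  move=> fd; apply: injective_extension => // x /res_exact0[y <-].
  exact: fd.
have augd' x : res_aug P (res_d P 0 x) = 0 by apply/res_exact0; exists x.
transitivity (row_exact k 0).
  split=> ex f.
    move=> df fd; have [f1 f1E] := factor1 f df.
    have [x|f' f'E] := ex f1.
      by apply: (@cores_aug_inj R W I); rewrite f1E fd linear0.
    by exists (cores_aug I \o f'); split=> x /=; rewrite -?f'E.
  move=> fd; have [x|x|f' [df' f'E]] := ex (cores_aug I \o f).
  - exact: augd.
  - by rewrite /= fd linear0.
  have [f1 f1E] := factor0 f' df'.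
  by exists f1 => x; apply: (@cores_aug_inj R W I); rewrite f1E -f'E.
rewrite -[in row_exact k 0](add0n k) -antidiagonal row_col.
split=> ex f df.
  have [x|x|h [hd hE]] := ex (f \o res_aug P).
  - by rewrite /= df.
  - by rewrite /= augd' linear0.
  have [h' h'E] := descend _ h hd.
  exists h' => x; have [y <-] := res_aug_surj P x.
  by rewrite h'E -hE.
move=> fd; have [f1 f1E] := descend _ f fd.
have [x|h hE] := ex f1.
  by have [y <-] := res_aug_surj P x; rewrite f1E.
exists (h \o res_aug P); split=> x /=; first by rewrite augd' linear0.
by rewrite -hE f1E.
Qed.

End Balance.

Section ExtVanishing.
Variables (R : nzRingType) (X : lmodType R).
Variable I : coresolution (R^o : lmodType R).
Hypothesis Iinj : forall n, injective_module (I n).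

Let dual_of (A : lmodType R) (f : {linear A -> R^o}) : dual A.
Proof.
apply: (@Dual R A f); apply/asboolP; exact: linearP.
Defined.

Let dual_linear_of (A : lmodType R) (f : dual A) : {linear A -> R^o} :=
  linear_of (dual_linear f).

Lemma ext0_zero : zero_module (ext 0 X) <->
  forall (f : {linear X -> R^o}) x, f x = 0.
Proof.
rewrite /ext ext_of_zero /=; split=> [ext0 f x|hom0 phi phi0].
  have [y <-] := res_aug_surj (free_resolution X) x.
  have /ext0/(congr1 (fun g : dual _ => g y)) // :
    dual_map (res_d (free_resolution X) 0)
      (dual_of (f \o res_aug (free_resolution X))) = 0.
  apply/val_inj/funext => z /=; rewrite -[RHS](linear0 f); congr (f _).
  by apply/(res_exact0 (r := free_resolution X)); exists z.
have /ext0_hom[psi [<- _]] :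
    phi \in ker_pred (dual_map (res_d (free_resolution X) 0)).
  by rewrite inE; apply/eqP.
by apply/val_inj/funext => x; exact: (hom0 (dual_linear_of psi)).
Qed.

Lemma extS_zero k : zero_module (ext k.+1 X) <->
  forall f : {linear X -> I k.+1}, (forall x, cores_d I k.+1 (f x) = 0) ->
    exists h : {linear X -> I k}, forall x, f x = cores_d I k (h x).
Proof.
rewrite -(ext_balance (@free_resolution_projective R X) Iinj) /ext ext_of_zero.
split=> ex.
  move=> f fd; have [|psi psiE] := ex (dual_of f).
    by apply/val_inj/funext.
  exists (dual_linear_of psi) => x.
  by have /(congr1 (fun g : dual _ => g x)) := psiE.
move=> phi phi0; have [x|psi psiE] := ex (dual_linear_of phi).
  by have /(congr1 (fun g : dual _ => g x)) := phi0.
by exists (dual_of psi); apply/val_inj/funext => x /=; rewrite -psiE.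
Qed.

Lemma ext_zero_of_hom i :
  (forall (f : {linear X -> I i}) x, f x = 0) -> zero_module (ext i X).
Proof.
case: i => [|i] hom0.
  apply/ext0_zero => f x; apply: (@cores_aug_inj _ _ I).
  by rewrite linear0; exact: (hom0 (cores_aug I \o f)).
by apply/extS_zero => f _; exists \0 => x; rewrite hom0 linear0.
Qed.

(** In degree 0 a map into the cycles of I_0 is a map into R, hence zero. The clause for i = 0 is
    recorded because [coaug_obj I 0] is R, along which maps cannot be extended by injectivity. *)
Lemma ext_zero_lift i (f : {linear X -> I i}) :
  zero_module (ext i X) -> (forall x, cores_d I i (f x) = 0) ->
  exists h : {linear X -> coaug_obj I i},
    (forall x, f x = coaug_d I i (h x)) /\ (i = 0%N -> forall x, h x = 0).
Proof.
case: i f => [|i] f ext0 df; last first.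
  by have [h hE] := (extS_zero i).1 ext0 f df; exists h.
have [s sE] := choice (fun x => (cores_exact0 (f x)).1 (df x)).
have s_lin : linear s.
  move=> c x y; apply: (@cores_aug_inj _ _ I).
  by rewrite linearP !sE linearP.
have /(_ (linear_of s_lin)) s0 := ext0_zero.1 ext0.
exists \0; split=> // x; rewrite -sE linear0.
by have := s0 x; rewrite /= /linear_fun => ->; rewrite linear0.
Qed.

End ExtVanishing.

(** * Finite free resolutions as sequences of matrices *)

Section MatrixAction.
Variable R : nzRingType.
Implicit Types V W : lmodType R.

(** This is A tensored with V, columns over R being free right modules. For V = R it is a map of
    right modules, and its dual is multiplication of row vectors by A. *)
Definition act m n V (A : 'M[R]_(m, n)) (y : 'I_n -> V) : 'I_m -> V :=
  fun i => \sum_j A i j *: y j.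

Definition rdot n V (y : 'I_n -> V) (v : 'rV[R]_n) : V :=
  \sum_j v 0 j *: y j.

Lemma rdot_linear n V (y : 'I_n -> V) : linear (rdot y).
Proof.
move=> a v w; rewrite /rdot scaler_sumr -big_split; apply: eq_bigr => j _.
by rewrite !mxE scalerDl scalerA.
Qed.

HB.instance Definition _ n V (y : 'I_n -> V) :=
  GRing.isLinear.Build R 'rV[R]_n V _ (rdot y) (rdot_linear y).

Lemma actM m n p V (A : 'M[R]_(m, n)) (B : 'M[R]_(n, p)) (y : 'I_p -> V) :
  act (A *m B) y = act A (act B y).
Proof.
apply/funext => i; rewrite /act.
under [RHS]eq_bigr do rewrite scaler_sumr.
rewrite exchange_big; apply: eq_bigr => k _.
by rewrite mxE scaler_suml; apply: eq_bigr => j _; rewrite scalerA.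
Qed.

Lemma actD m n V (A : 'M[R]_(m, n)) (y z : 'I_n -> V) :
  act A (y + z) = act A y + act A z.
Proof.
apply/funext => i; transitivity (act A y i + act A z i) => //.
rewrite /act -big_split /=.
by apply: eq_bigr => j _; rewrite -scalerDr.
Qed.

Lemma actN m n V (A : 'M[R]_(m, n)) (y : 'I_n -> V) : act A (- y) = - act A y.
Proof.
apply/funext => i; transitivity (- act A y i) => //; rewrite /act -sumrN.
by apply: eq_bigr => j _; rewrite -scalerN.
Qed.

Lemma actB m n V (A : 'M[R]_(m, n)) (y z : 'I_n -> V) :
  act A (y - z) = act A y - act A z.
Proof. by rewrite actD actN. Qed.

Lemma act0 m n V (A : 'M[R]_(m, n)) : act A (0 : 'I_n -> V) = 0.
Proof. by apply/funext => i; apply: big1 => j _; rewrite scaler0. Qed.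

Lemma act0mx m n V (y : 'I_n -> V) : act (0 : 'M[R]_(m, n)) y = 0.
Proof. by apply/funext => i; apply: big1 => j _; rewrite mxE scale0r. Qed.

Lemma actNmx m n V (A : 'M[R]_(m, n)) (y : 'I_n -> V) : act (- A) y = - act A y.
Proof.
apply/funext => i; transitivity (- act A y i) => //; rewrite /act -sumrN.
by apply: eq_bigr => j _; rewrite mxE scaleNr.
Qed.

Lemma act_map m n V W (f : {linear V -> W}) (A : 'M[R]_(m, n)) (y : 'I_n -> V) :
  f \o act A y = act A (f \o y).
Proof.
apply/funext => i; rewrite /= linear_sum; apply: eq_bigr => j _.
by rewrite linearZ.
Qed.

Lemma rdot_mul m n V (v : 'rV[R]_m) (A : 'M[R]_(m, n)) (y : 'I_n -> V) :
  rdot y (v *m A) = rdot (act A y) v.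
Proof. by have /(congr1 (fun f => f 0)) := actM v A y. Qed.

Lemma rdot_row m n V (A : 'M[R]_(m, n)) (y : 'I_n -> V) i :
  rdot y (row i A) = act A y i.
Proof. by apply: eq_bigr => j _; rewrite mxE. Qed.

Lemma rdot_delta n V (y : 'I_n -> V) j : rdot y (delta_mx 0 j) = y j.
Proof.
rewrite /rdot (bigD1 j) //= mxE !eqxx scale1r big1 ?addr0 // => k /negPf kj.
by rewrite mxE kj andbF scale0r.
Qed.

Lemma linear_rdot n V (f : {linear 'rV[R]_n -> V}) v :
  f v = rdot (fun j => f (delta_mx 0 j)) v.
Proof.
by rewrite [v in LHS]row_sum_delta linear_sum; apply: eq_bigr => j _;
  rewrite linearZ.
Qed.

Lemma rV_projective n : projective_module 'rV[R]_n.
Proof.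
move=> A B p f p_surj.
have [s sE] := choice (fun j : 'I_n => p_surj (f (delta_mx 0 j))).
exists (rdot s) => v; rewrite [RHS]linear_rdot linear_sum.
by apply: eq_bigr => j _; rewrite linearZ /= sE.
Qed.

End MatrixAction.

Section Span.
Variable R : nzRingType.
Implicit Types A B V : lmodType R.

Definition submodule V (N : V -> Prop) : Prop :=
  N 0 /\ forall a x y, N x -> N y -> N (a *: x + y).

Fixpoint span V (s : seq V) (y : V) : Prop :=
  if s is x :: s' then exists c z, span s' z /\ y = c *: x + z else y = 0.

Lemma span_submodule V (s : seq V) : submodule (span s).
Proof.
elim: s => [|x s [IH0 IHD]] /=.
  by split=> // a x y -> ->; rewrite scaler0 addr0.
split=> [|a y y' [c [z [sz ->]]] [c' [z' [sz' ->]]]].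
  by exists 0, 0; rewrite scale0r addr0.
exists (a * c + c'), (a *: z + z'); split; first exact: IHD.
by rewrite scalerDr scalerDl addrACA scalerA.
Qed.

Lemma span_cat V (s1 s2 : seq V) y1 y2 :
  span s1 y1 -> span s2 y2 -> span (s1 ++ s2) (y1 + y2).
Proof.
elim: s1 y1 => [|x s1 IH] y1 /=; first by move=> ->; rewrite add0r.
move=> [c [z [sz ->]]] sy2; exists c, (z + y2); split; first exact: IH.
by rewrite addrA.
Qed.

Lemma span_sub V (N : V -> Prop) (s : seq V) :
  submodule N -> (forall x, x \in s -> N x) -> forall y, span s y -> N y.
Proof.
move=> [N0 ND]; elim: s => [|x s IH] sN y /=; first by move=> ->.
move=> [c [z [sz ->]]]; apply: ND; first by apply: sN; rewrite mem_head.
by apply: IH sz => w ws; apply: sN; rewrite inE ws orbT.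
Qed.

Lemma mem_span V (s : seq V) x : x \in s -> span s x.
Proof.
elim: s => // x' s IH.
rewrite inE => /orP[/eqP ->|xs] /=.
  exists 1, 0; rewrite scale1r addr0; split=> //.
  by have [] := span_submodule s.
by exists 0, x; rewrite scale0r add0r; split=> //; exact: IH.
Qed.

Definition span_fg V (N : V -> Prop) : Prop :=
  exists s, forall y, N y <-> span s y.

Lemma span_lift A B (p : {linear A -> B}) (N : A -> Prop) (s : seq B) :
  submodule N -> (forall b, span s b -> exists a, N a /\ p a = b) ->
  exists s', (forall a, span s' a -> N a) /\
    forall b, span s b -> exists a, span s' a /\ p a = b.
Proof.
move=> Nsub; elim: s => [|x s IH] sN.
  exists [::]; split=> [a ->|b ->]; first by case: Nsub.
  by exists 0; rewrite linear0.
have [|s' [s'N s's]] := IH.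
  move=> b sb; apply: sN; exists 0, b; by rewrite scale0r add0r.
have [a [Na pa]] := sN x (mem_span (mem_head x s)).
exists (a :: s'); split=> [_ [c [z [sz ->]]]|_ [c [z [sz ->]]]].
  by case: Nsub => _; apply=> //; exact: s'N.
have [a' [s'a' pa']] := s's z sz.
exists (c *: a + a'); split; first by exists c, a'.
by rewrite linearP pa pa'.
Qed.

Lemma span_fg_extension A B (p : {linear A -> B}) (N : A -> Prop) :
  submodule N -> span_fg (fun b => exists a, N a /\ p a = b) ->
  span_fg (fun a => N a /\ p a = 0) -> span_fg N.
Proof.
move=> Nsub [s sP] [t tP].
have [|s' [s'N s's]] := @span_lift A B p N s Nsub; first by move=> b /sP.
have [N0 ND] := Nsub.
exists (s' ++ t) => a; split=> [Na|].
  have [a' [sa' pa']] : exists a', span s' a' /\ p a' = p a.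
    by apply/s's/sP; exists a.
  rewrite -(subrK a' a) addrC; apply: span_cat => //; apply/tP; split.
    by rewrite addrC -scaleN1r; apply: ND => //; exact: s'N.
  by rewrite linearB /= pa' subrr.
apply: span_sub => // x; rewrite mem_cat => /orP[/mem_span/s'N //|/mem_span/tP].
by case.
Qed.

(** Otherwise dependent choice adjoins, forever, an element of N outside the current span, and the
    spans form a strictly ascending chain. *)
Lemma noetherian_ideal_fg (N : R^o -> Prop) :
  left_noetherian R -> submodule N -> span_fg N.
Proof.
move=> noeth [N0 ND]; apply: contrapT => Nfg.
pose good (s : seq R^o) := forall y, span s y -> N y.
pose rel (s s' : seq R^o) := exists x, s' = x :: s /\ ~ span s x.
have [|_ s sN|f [_ fP]] :=
  @dependent_choice (fun _ => seq R^o) (fun _ => good) (fun _ => rel) [::].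
- by move=> y ->.
- have [x [Nx sx]] : exists x, N x /\ ~ span s x.
    apply: contrapT => nex; apply: Nfg; exists s => y; split; last exact: sN.
    by move=> Ny; apply: contrapT => sy; apply: nex; exists y.
  exists (x :: s); split; last by exists x.
  by move=> y [c [z [sz ->]]]; apply: ND => //; exact: sN.
pose T k : {pred R^o} := fun y => `[< span (f k) y >].
have [k|k y /asboolP sy|m mP] := noeth T.
- split=> [|a y z /asboolP sy /asboolP sz]; apply/asboolP;
    have [s0 sD] := span_submodule (f k); [exact: s0 | exact: sD].
- have [_ [x [fE _]]] := fP k; apply/asboolP; rewrite fE; exists 0, y.
  by rewrite scale0r add0r.
have [_ [x [fE fx]]] := fP m; apply: fx; apply/asboolP.
have := mP m.+1 (leqnSn m) x; rewrite !unfold_in => <-; apply/asboolP.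
by rewrite fE; exact: mem_span (mem_head _ _).
Qed.

(** Induction through the first coordinate: its image is a left ideal, its kernel a submodule of a
    smaller row space. *)
Lemma noetherian_rV_fg n (N : 'rV[R]_n -> Prop) :
  left_noetherian R -> submodule N -> span_fg N.
Proof.
move=> noeth; elim: n N => [|n IH] N [N0 ND].
  by exists [::] => y; split=> [_|->//]; rewrite [y]thinmx0.
have plin : linear (fun v : 'rV[R]_n.+1 => v 0 0 : R^o).
  by move=> a v w; rewrite !mxE.
have jlin : linear (fun w : 'rV[R]_n => row_mx 0 w : 'rV[R]_(1 + n)).
  by move=> a v w; rewrite scale_row_mx add_row_mx scaler0 addr0.
apply: (@span_fg_extension _ _ (linear_of plin)) => //.
  apply: noetherian_ideal_fg => //; split.
    by exists 0; rewrite linear0.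
  move=> c _ _ [a [Na <-]] [b [Nb <-]]; exists (c *: a + b).
  by rewrite linearP; split=> //; exact: ND.
have [|s sP] := IH (fun w => N (linear_of jlin w)).
  split=> [|c v w Nv Nw]; first by rewrite linear0.
  by rewrite linearP; exact: ND.
exists (map (linear_of jlin) s) => v; split=> [[Nv v0]|].
  have vE : v = linear_of jlin (@rsubmx _ 1 1 n v).
    have l0 : @lsubmx _ 1 1 n v = 0.
      apply/matrixP => i j; rewrite !ord1 mxE [RHS]mxE -[RHS]v0 /=.
      by congr (v _ _); apply: val_inj.
    by rewrite -[LHS](@hsubmxK _ 1 1 n) l0.
  rewrite vE; rewrite vE in Nv; move: (rsubmx _) Nv => w /sP {sP v0 vE}.
  elim: s w => [|x s IHs] w /=; first by move=> ->; rewrite linear0.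
  move=> [c [z [/IHs sz ->]]]; exists c, (linear_of jlin z).
  by rewrite linearP.
apply: (@span_sub _ (fun v => N v /\ linear_of plin v = 0)).
  split=> [|c x y [Nx x0] [Ny y0]]; first by rewrite linear0.
  by rewrite linearP x0 y0 scaler0 addr0; split=> //; exact: ND.
move=> _ /mapP[w /mem_span/sP Nw ->]; split=> //.
transitivity ((0 : 'rV[R]_1) 0 0); last by rewrite mxE.
rewrite -(row_mxEl (0 : 'rV[R]_1) w 0 0) /= /linear_fun.
by congr (row_mx _ _ _ _); apply: val_inj.
Qed.

Lemma noetherian_generators n (N : 'rV[R]_n -> Prop) :
  left_noetherian R -> submodule N ->
  exists m (G : 'M[R]_(m, n)), forall v, N v <-> exists w, v = w *m G.
Proof.
move=> noeth Nsub; have [s sP] := noetherian_rV_fg noeth Nsub.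
exists (size s), (\matrix_(i < size s) nth 0 s i) => v; rewrite sP => {sP}.
split=> [|[w ->]].
  elim: s v => [|x s IH] v /=; first by move=> ->; exists 0; rewrite mul0mx.
  move=> [c [z [/IH[w ->] ->]]].
  exists (row_mx (c%:M : 'rV_1) w : 'rV_(1 + size s)).
  rewrite [RHS]mulmx_sum_row big_ord_recl; congr (_ + _).
    rewrite rowK /=; congr (_ *: _).
    transitivity ((c%:M : 'rV_1) 0 0); first by rewrite mxE eqxx.
    rewrite -(row_mxEl (c%:M : 'rV_1) w 0 0).
    by congr (row_mx _ _ _ _); apply: val_inj.
  rewrite mulmx_sum_row; apply: eq_bigr => i _; rewrite !rowK /=.
  congr (_ *: _); rewrite -(row_mxEr (c%:M : 'rV_1) w 0 i).
  by congr (row_mx _ _ _ _); apply: val_inj.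
have [s0 sD] := span_submodule s.
rewrite mulmx_sum_row; elim/big_ind: _ => // [x y sx sy|i _].
  by rewrite -[x]scale1r; exact: sD.
rewrite -[_ *: _]addr0; apply: sD => //; rewrite rowK.
by apply: mem_span; exact: mem_nth.
Qed.

End Span.

Section FreePresentation.
Variable R : nzRingType.

(* ... -> R^(n 2) -> R^(n 1) -> V, shifted by one so that [B 0] is the empty
   matrix; this removes the case distinction in degree 0 below. *)
Definition matrix_resolution (V : lmodType R) (n : nat -> nat)
    (B : forall k, 'M[R]_(n k.+1, n k)) (a : {linear 'rV[R]_(n 1%N) -> V}) :=
  [/\ n 0%N = 0%N, forall x, exists v, a v = x,
      forall v, a v = 0 <-> exists w, v = w *m B 1%N &
      forall k (v : 'rV_(n k.+2)),
        v *m B k.+1 = 0 <-> exists w, v = w *m B k.+2].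

Lemma matrix_resolution_exists (V : lmodType R) :
  left_noetherian R -> finitely_generated V ->
  exists n B a, @matrix_resolution V n B a.
Proof.
move=> noeth [n1 [g gP]]; pose a := rdot g : {linear 'rV[R]_n1 -> V}.
have [|n2 [B1 B1P]] := @noetherian_generators _ _ (fun v => a v = 0) noeth.
  split=> [|c x y x0 y0]; first by rewrite linear0.
  by rewrite linearP x0 y0 scaler0 addr0.
(* The sizes arise together with the matrices, so the iteration runs on a sigma type. [step] makes
   the old row count the new column count by conversion, so no casts are needed. *)
pose T := {i : nat & {j : nat & 'M[R]_(j, i)}}.
have next (j i : nat) (B : 'M[R]_(j, i)) :
    {k : nat & {G : 'M[R]_(k, j) |
      forall v : 'rV_j, v *m B = 0 <-> exists w, v = w *m G}}.
  have kerB : submodule (fun v : 'rV_j => v *m B = 0).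
    split=> [|c x y x0 y0]; first by rewrite mul0mx.
    by rewrite mulmxDl -scalemxAl x0 y0 scaler0 addr0.
  have /cid[k /cid[G GP]] := noetherian_generators noeth kerB.
  by exists k; exists G.
pose step (t : T) : T :=
  existT _ (projT1 (projT2 t))
    (existT _ (projT1 (next _ _ (projT2 (projT2 t))))
      (sval (projT2 (next _ _ (projT2 (projT2 t)))))).
pose st k := iter k step (existT _ n1 (existT _ n2 B1) : T).
pose n k := if k is k'.+1 then projT1 (st k') else 0%N.
pose B k : 'M[R]_(n k.+1, n k) :=
  if k is k'.+1 then projT2 (projT2 (st k')) else 0.
exists n, B, a; split=> //.
  by move=> x; have [c ->] := gP x; exists (\row_j c j);
    apply: eq_bigr => j _; rewrite mxE.
by move=> k v; exact: (svalP (projT2 (next _ _ (projT2 (projT2 (st k)))))).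
Qed.

Section ExtMatrix.
Variables (V : lmodType R) (n : nat -> nat).
Variable B : forall k, 'M[R]_(n k.+1, n k).
Variable a : {linear 'rV[R]_(n 1%N) -> V}.
Hypothesis Bres : matrix_resolution B a.

Let Bd k : {linear 'rV[R]_(n k.+2) -> 'rV[R]_(n k.+1)} := mulmxr (B k.+1).

Fact matrix_resolution_surj x : exists v, a v = x.
Proof. by case: Bres. Qed.

Fact matrix_resolution_exact0 v : a v = 0 <-> exists w, Bd 0 w = v.
Proof. by case: Bres => _ _ -> _; split=> -[w]; exists w. Qed.

Fact matrix_resolution_exactS k v : Bd k v = 0 <-> exists w, Bd k.+1 w = v.
Proof. by case: Bres => _ _ _ BP; rewrite BP; split=> -[w]; exists w. Qed.

Definition resolution_of_matrices : resolution V :=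
  @Resolution R V (fun k => 'rV[R]_(n k.+1)) Bd a matrix_resolution_surj
    matrix_resolution_exact0
    matrix_resolution_exactS.

(* [Ext^i(V, R)] is [{y | B_(i+1) y = 0} / im B_i], a right module under
   entrywise multiplication. *)
Lemma ext_matrix i : exists cls : ('I_(n i.+1) -> R^o) -> ext i V,
  [/\ forall y z, act (B i.+1) y = 0 -> act (B i.+1) z = 0 ->
        cls (y + z) = cls y + cls z,
      forall (c : R) (y : 'I_(n i.+1) -> R^o), act (B i.+1) y = 0 ->
        cls (fun j => (y j : R) * c : R^o) = (c : R^c) *: cls y,
      forall e, exists y, act (B i.+1) y = 0 /\ cls y = e &
      forall y, act (B i.+1) y = 0 ->
        (cls y = 0 <-> exists z, y = act (B i) z)].
Proof.
pose P := resolution_of_matrices.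
have Pproj : projective_resolution P by move=> k; exact: rV_projective.
have [cls [cls_surj cls0]] :=
  ext_of_comparison Pproj (@free_resolution_projective R V) i.
have rdotP k (y : 'I_(n k.+1) -> R^o) :
    (rdot y : 'rV[R]_(n k.+1) -> R^c^o) \in dual_pred _.
  by apply/asboolP; exact: rdot_linear.
pose phi k y : dual (P k) := Dual (rdotP k y).
have phiE k (f : dual (P k)) : f = phi k (fun j => f (delta_mx 0 j)).
  by apply/val_inj/funext => v;
    exact: (linear_rdot (linear_of (dual_linear f))).
have phi_inj k : injective (phi k).
  move=> y z /(congr1 (fun f : dual _ => fun j => f (delta_mx 0 j))) /=.
  by move=> yz; apply/funext => j; have /(congr1 (fun f => f j)) := yz;
    rewrite !rdot_delta.
have phid k y : dual_map (res_d P k) (phi k y) = phi k.+1 (act (B k.+1) y).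
  by apply/val_inj/funext => v; exact: (rdot_mul v (B k.+1) y).
have phi00 k : phi k 0 = 0.
  by apply/val_inj/funext => v; apply: big1 => j _; exact: (mulr0 (v 0 j : R)).
have phiK y : act (B i.+1) y = 0 ->
    phi i y \in ker_pred (dual_map (res_d P i)).
  by move=> y0; rewrite inE phid y0 phi00.
have cob y : coboundary (phi i y) <-> exists z, y = act (B i) z.
  case: (i) y => [|k] y /=.
    (* In degree 0 both sides say that [y] is zero, because [B 0] has no columns. *)
    split=> [|[z ->]].
      rewrite -phi00 => /phi_inj ->; exists 0; by rewrite act0.
    rewrite -phi00; congr (phi 0%N _); apply/funext => j.
    apply: big1 => l _; have [n0 _ _ _] := Bres.
    by have := ltn_ord l; rewrite [X in (_ < X)%N]n0.
  split=> [[f fE]|[z ->]]; last by exists (phi k z); exact: phid.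
  by move: fE; rewrite (phiE _ f) phid => /phi_inj <-; eexists.
(* A total function, with the dummy value 0 off the cocycles. *)
pose F (y : 'I_(n i.+1) -> R^o) : ext i V :=
  if pselect (act (B i.+1) y = 0) is left y0
  then cls (Kernel (phiK y y0)) else 0.
have FE y (z : cocycle P i) :
    act (B i.+1) y = 0 -> val z = phi i y -> F y = cls z.
  move=> y0 zE; rewrite /F; case: pselect => // y0'.
  by congr (cls _); apply: val_inj.
have actZ (y : 'I_(n i.+1) -> R^o) (c : R) :
    act (B i.+1) y = 0 -> act (B i.+1) (fun j => (y j : R) * c : R^o) = 0.
  move=> y0; apply/funext => j.
  transitivity ((act (B i.+1) y j : R) * c); last by rewrite y0; exact: mul0r.
  by rewrite mulr_suml; apply: eq_bigr => l _; exact: mulrA.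
exists F; split=> [y z y0 z0|c y y0|e|y y0].
- rewrite (FE _ (Kernel (phiK y y0)) y0) // (FE _ (Kernel (phiK z z0)) z0) //.
  rewrite -linearD; apply: FE; first by rewrite actD y0 z0 addr0.
  apply/val_inj/funext => v /=.
  rewrite -[LHS]/(rdot y v + rdot z v) /rdot -big_split /=.
  by apply: eq_bigr => j _; rewrite -scalerDr.
- rewrite (FE _ (Kernel (phiK y y0)) y0) // -linearZ; apply: FE;
  first exact: actZ.
  apply/val_inj/funext => v /=.
  rewrite -[LHS]/((rdot y v : R) * c) /rdot mulr_suml.
  by apply: eq_bigr => j _; exact: mulrA.
- have [z <-] := cls_surj e.
  pose y j := (val z : dual (P i)) (delta_mx 0 j) : R^o.
  have y0 : act (B i.+1) y = 0.
    by apply: phi_inj; rewrite -phid -phiE phi00; exact: (kernelP z).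
  by exists y; split=> //; apply: FE => //; exact: phiE.
rewrite (FE _ (Kernel (phiK y y0)) y0) // cls0; exact: cob.
Qed.

End ExtMatrix.

End FreePresentation.

(** * Flat modules and vanishing of Tor *)

Section PureTensors.
Variables (R : nzRingType) (A : lmodType R^c) (F : lmodType R).

Lemma tensor_classB (u v : {freeg (A * F)%type / int}) :
  tensor_class (u - v) = tensor_class u - tensor_class v.
Proof.
rewrite /tensor_class (Quotient.pi_add (tensor_rel A F)).
by rewrite (Quotient.pi_opp (tensor_rel A F)).
Qed.

Lemma tensor_class_eq0 (u : {freeg (A * F)%type / int}) :
  tensor_class u = 0 <-> u \in tensor_rel A F.
Proof.
rewrite -[u in u \in _](subr0 u) Quotient.idealrBE.
have -> : (\pi_(Quotient.quot (tensor_rel A F)) 0)%qT = 0 :> tensor A F.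
  have := tensor_classB 0 0; rewrite !subrr => /esym/eqP; rewrite eq_sym.
  by move/eqP.
by split=> /eqP.
Qed.

Lemma tensor_relator_class r : 
  tensor_relator r -> tensor_class r = 0 :> tensor A F.
Proof. by move=> rr; apply/tensor_class_eq0/asboolP => N _; apply. Qed.

Lemma pure_tensorDl a a' x :
  pure_tensor (a + a') x = pure_tensor a x + pure_tensor a' x :> tensor A F.
Proof.
apply/eqP; rewrite -subr_eq0 opprD addrA -!tensor_classB; apply/eqP.
by apply: tensor_relator_class; apply: Or31; exists a, a', x.
Qed.

Lemma pure_tensorDr a x x' :
  pure_tensor a (x + x') = pure_tensor a x + pure_tensor a x' :> tensor A F.
Proof.
apply/eqP; rewrite -subr_eq0 opprD addrA -!tensor_classB; apply/eqP.
by apply: tensor_relator_class; apply: Or32; exists a, x, x'.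
Qed.

Lemma pure_tensorZ (c : R) a x :
  pure_tensor ((c : R^c) *: a) x = pure_tensor a (c *: x) :> tensor A F.
Proof.
apply/eqP; rewrite -subr_eq0 -!tensor_classB; apply/eqP.
by apply: tensor_relator_class; apply: Or33; exists a, c, x.
Qed.

Lemma pure_tensor0r a : pure_tensor a 0 = 0 :> tensor A F.
Proof.
by apply: (@addrI _ (pure_tensor a 0)); rewrite -pure_tensorDr !addr0.
Qed.

Lemma pure_tensor0l x : pure_tensor 0 x = 0 :> tensor A F.
Proof.
by apply: (@addrI _ (pure_tensor 0 x)); rewrite -pure_tensorDl !addr0.
Qed.

Lemma pure_tensor_suml n (a : 'I_n -> A) x :
  pure_tensor (\sum_i a i) x = \sum_i pure_tensor (a i) x :> tensor A F.
Proof.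
apply: (big_morph (fun a => pure_tensor a x)); last exact: pure_tensor0l.
by move=> b b'; exact: pure_tensorDl.
Qed.

Lemma pure_tensor_sumr n a (x : 'I_n -> F) :
  pure_tensor a (\sum_i x i) = \sum_i pure_tensor a (x i) :> tensor A F.
Proof.
apply: (big_morph (pure_tensor a)); last exact: pure_tensor0r.
by move=> b b'; exact: pure_tensorDr.
Qed.

Lemma tensor_class_sum n (u : 'I_n -> {freeg (A * F)%type / int}) :
  tensor_class (\sum_i u i) = \sum_i tensor_class (u i).
Proof.
have class0 : tensor_class 0 = 0 :> tensor A F.
  by rewrite -(subrr 0) tensor_classB subrr.
apply: (big_morph (@tensor_class R A F)) => // u1 u2.
rewrite -[u2 in LHS]opprK tensor_classB -[- u2]sub0r tensor_classB.
by rewrite class0 sub0r opprK.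
Qed.

End PureTensors.

Section Flatness.
Variable R : nzRingType.

Definition column_exact m n p (D : 'M[R]_(m, n)) (D' : 'M[R]_(n, p)) : Prop :=
  forall x : 'I_n -> R^o, act D x = 0 -> exists z : 'I_p -> R^o, x = act D' z.

(* Flatness is applied to the embedding of [R^n / ker D] into [R^m]; lifting
   its elements to [R^n] is well defined only modulo [im D'], which is why the
   comparison with [F^n] is made through the subgroup [D' F^p]. *)
Lemma flat_column_exact (F : lmodType R) m n p
    (D : 'M[R]_(m, n)) (D' : 'M[R]_(n, p)) (y : 'I_n -> F) :
  flat_module F -> column_exact D D' -> act D y = 0 ->
  exists z : 'I_p -> F, y = act D' z.
Proof.
move=> Fflat DD' Dy.
pose q : {linear 'rV[R^c]_n -> 'rV[R^c]_m} := mulmxr (D^T : 'M[R^c]_(n, m)).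
have [h [h_inj hE]] := coimage_embedding q.
set A := quotient_module _ in h h_inj hE.
pose cl : {linear 'rV[R^c]_n -> A} := quotient_class (ker_submod q).
pose im (w : 'I_n -> F) := exists z : 'I_p -> F, w = act D' z.
have imB u v : im u -> im v -> im (u - v).
  by move=> [z ->] [z' ->]; exists (z - z'); rewrite actB.
have im0 : im 0 by exists 0; rewrite act0.
have key (w : 'rV[R^c]_n) x : q w = 0 -> im (fun j => (w 0 j : R) *: x).
  move=> qw; have [|z zE] := DD' (fun j => w 0 j : R).
    apply/funext => i; have /matrixP/(_ 0 i) := qw.
    rewrite !mxE => qwi; rewrite -[RHS]qwi.
    by apply: eq_bigr => j _; rewrite !mxE.
  exists (fun k => (z k : R) *: x); apply/funext => j.
  have /(congr1 (fun f => (f j : R) *: x)) /= -> := zE.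
  by rewrite scaler_suml; apply: eq_bigr => k _; rewrite scalerA.
pose f (ax : A * F) : zmodule ('I_n -> F) :=
  fun j => (repr ax.1 0 j : R) *: ax.2.
have key2 (a : A) (w : 'rV[R^c]_n) x : cl w = a ->
    im (f (a, x) - fun j => (w 0 j : R) *: x).
  move=> <-; have [|z zE] := key (repr (cl w) - w) x.
    rewrite linearB -!hE; apply/eqP; rewrite subr_eq0; apply/eqP.
    by congr (h _); exact: quotient_classK.
  exists z; rewrite -zE; apply/funext => j.
  transitivity ((repr (cl w) 0 j : R) *: x - (w 0 j : R) *: x) => //.
  by rewrite -scalerBl !mxE.
pose g : {linear {freeg (A * F)%type / int} -> zmodule ('I_n -> F)} := fglift f.
have gU a x : g << (a, x) >> = f (a, x) by exact: fglift1.
pose N : {pred {freeg (A * F)%type / int}} := fun t => `[< im (g t) >].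
have Nz : zmod_closed N.
  split=> [|u v /asboolP Nu /asboolP Nv]; apply/asboolP;
    first by rewrite linear0.
  by rewrite linearB; exact: imB.
have imD u v : im u -> im v -> im (u + v).
  by move=> [z ->] [z' ->]; exists (z + z'); rewrite actD.
have Nr r : tensor_relator r -> r \in N.
  move=> rr; apply/asboolP.
  case: rr => [[a [a' [x ->]]]|[a [x [x' ->]]]|[a [c [x ->]]]].
  - rewrite !linearB !gU.
    have -> : f (a + a', x) - f (a, x) - f (a', x) =
        f (a + a', x) - fun j => ((repr a + repr a') 0 j : R) *: x.
      rewrite -addrA -opprD; congr (_ - _); apply/funext => j.
      by rewrite mxE scalerDl.
    by apply: key2; rewrite linearD /= /cl /= !quotient_classK.
  - rewrite !linearB !gU.
    suff -> : f (a, x + x') - f (a, x) - f (a, x') = 0 by [].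
    apply/eqP; rewrite -addrA -opprD subr_eq0; apply/eqP/funext => j.
    exact: scalerDr.
  - rewrite !linearB !gU.
    have -> : f (a, c *: x) = fun j => (((c : R^c) *: repr a) 0 j : R) *: x.
      by apply/funext => j; rewrite mxE /f /= scalerA.
    by apply: key2; rewrite linearZ /= /cl /= quotient_classK.
pose e j : 'rV[R^c]_n := delta_mx 0 j.
(* The tensor of the classes of the unit vectors with the entries of [y]. Under [h] it becomes the
   tensor form of D y = 0, so flatness makes it zero; and [g t] equals [y] modulo the image of
   D'. *)
pose t : {freeg (A * F)%type / int} := \sum_j << (cl (e j), y j) >>.
have t0 : tensor_class t = 0.
  apply: (Fflat _ _ h h_inj).
  have -> : (0 : tensor A F) = tensor_class 0.
    by apply/esym/tensor_class_eq0; exact: rpred0.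
  rewrite !tensor_map_class.
  have -> : pre_tensor_map (F := F) h 0 = 0 by exact: linear0.
  have -> : pre_tensor_map h t = \sum_j << (q (e j), y j) >>.
    rewrite /t [LHS](linear_sum (fglift _)); apply: eq_bigr => j _.
    by rewrite [LHS]fglift1 /= hE.
  rewrite tensor_class_sum.
  have -> : tensor_class (0 : {freeg ('rV[R^c]_m * F)%type / int}) = 0.
    by apply/tensor_class_eq0; exact: rpred0.
  have qe j : q (e j) = \sum_i (D i j : R^c) *: delta_mx 0 i.
    by rewrite /q /= -rowE [LHS]row_sum_delta; apply: eq_bigr => i _;
      rewrite !mxE.
  under eq_bigr => j _.
    rewrite -/(pure_tensor _ _) qe pure_tensor_suml.
    under eq_bigr => i _ do rewrite pure_tensorZ.
    over.
  rewrite exchange_big big1 //= => i _; rewrite -pure_tensor_sumr.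
  have -> : \sum_j D i j *: y j = 0 by have /(congr1 (fun w => w i)) := Dy.
  exact: pure_tensor0r.
have /asboolP imt : t \in N by have /tensor_class_eq0/asboolP/(_ N Nz Nr) := t0.
have -> : y = g t - (g t - y) by rewrite opprB addrCA subrr addr0.
apply: imB => //.
have -> : g t - y = \sum_j (f (cl (e j), y j) - fun k => (e j 0 k : R) *: y j).
  rewrite sumrB; congr (_ - _).
    by rewrite linear_sum; apply: eq_bigr => j _; rewrite gU.
  apply/funext => k; rewrite fct_sumE (bigD1 k) //= big1 => [|j /negPf jk].
    by rewrite mxE !eqxx scale1r addr0.
  by rewrite mxE eq_sym jk andbF scale0r.
elim/big_ind: _ => // j _; exact: key2.
Qed.

End Flatness.

Section BlockVectors.
Variables (R : nzRingType) (V : lmodType R).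

Lemma vector_lift (A B : lmodType R) n (f : {linear A -> B}) (y : 'I_n -> B) :
  (forall i, exists x, f x = y i) -> exists x, f \o x = y.
Proof. by move=> /choice[x xE]; exists x; apply/funext => i; exact: xE. Qed.

Lemma vector0 n (y z : 'I_n -> V) : n = 0%N -> y = z.
Proof.
move=> n0; apply/funext => i; have := ltn_ord i.
by rewrite [X in (_ < X)%N]n0.
Qed.

Definition pair_vec a b (y : 'I_a -> V) (z : 'I_b -> V) : 'I_(a + b) -> V :=
  fun i => match fintype.split i with inl j => y j | inr k => z k end.

Lemma pair_vec_l a b (y : 'I_a -> V) (z : 'I_b -> V) j :
  pair_vec y z (lshift b j) = y j.
Proof. by rewrite /pair_vec (unsplitK (inl j)). Qed.

Lemma pair_vec_r a b (y : 'I_a -> V) (z : 'I_b -> V) j :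
  pair_vec y z (rshift a j) = z j.
Proof. by rewrite /pair_vec (unsplitK (inr j)). Qed.

Lemma pair_vecP a b (x : 'I_(a + b) -> V) : exists y z, x = pair_vec y z.
Proof.
exists (x \o @lshift a b), (x \o @rshift a b); apply/funext => i.
by rewrite /pair_vec; case: split_ordP => j ->.
Qed.

Lemma pair_vec_eq a b (y y' : 'I_a -> V) (z z' : 'I_b -> V) :
  pair_vec y z = pair_vec y' z' <-> y = y' /\ z = z'.
Proof.
split=> [E|[-> ->] //]; split; apply/funext => j.
  by rewrite -(pair_vec_l y z) E pair_vec_l.
by rewrite -(pair_vec_r y z) E pair_vec_r.
Qed.

Lemma pair_vec_eq0 a b (y : 'I_a -> V) (z : 'I_b -> V) :
  pair_vec y z = 0 <-> y = 0 /\ z = 0.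
Proof.
rewrite -pair_vec_eq; suff -> : pair_vec 0 0 = 0 :> ('I_(a + b) -> V) by [].
by apply/funext => i; rewrite /pair_vec; case: fintype.split.
Qed.

Lemma act_row_mx m a b (A : 'M[R]_(m, a)) (B : 'M[R]_(m, b)) y z :
  act (row_mx A B) (pair_vec y z) = act A y + act B z.
Proof.
apply/funext => i; transitivity (act A y i + act B z i) => //.
rewrite /act big_split_ord; congr (_ + _); apply: eq_bigr => j _.
  by rewrite row_mxEl pair_vec_l.
by rewrite row_mxEr pair_vec_r.
Qed.

Lemma act_col_mx m1 m2 n (A : 'M[R]_(m1, n)) (B : 'M[R]_(m2, n)) y :
  act (col_mx A B) y = pair_vec (act A y) (act B y).
Proof.
apply/funext => i; case: (split_ordP i) => j ->.
  by rewrite pair_vec_l; apply: eq_bigr => k _; rewrite col_mxEu.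
by rewrite pair_vec_r; apply: eq_bigr => k _; rewrite col_mxEd.
Qed.

Lemma act_block_mx m1 m2 a b (A : 'M[R]_(m1, a)) (B : 'M[R]_(m1, b))
    (C : 'M[R]_(m2, a)) (D : 'M[R]_(m2, b)) y z :
  act (block_mx A B C D) (pair_vec y z) =
  pair_vec (act A y + act B z) (act C y + act D z).
Proof. by rewrite act_col_mx !act_row_mx. Qed.

End BlockVectors.

Section TorVanishing.
Variable R : nzRingType.
Variables (s : nat -> nat) (D : forall k, 'M[R]_(s k, s k.+1)).
Hypotheses (DD : forall k, D k *m D k.+1 = 0)
           (Dex : forall k, column_exact (D k) (D k.+1)).

(** Tor_(k+1) of the cokernel of [D 0], by dimension shifting. In [shift] the image of [aug_d F t]
    replaces I, a t-th syzygy; k falls as t grows, until k = 0 and N <= t. Then F_(t+1) = 0, so [y1]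
    itself is a cycle and flatness of F_t applies. *)
Lemma tor_vanishing (I : lmodType R) N k (y : 'I_(s k.+1) -> I) :
  flat_dim_le I N -> (N <= k)%N -> act (D k) y = 0 ->
  exists z : 'I_(s k.+2) -> I, y = act (D k.+1) z.
Proof.
move=> [F [Fflat F0]].
suff shift t (y1 : 'I_(s k.+1) -> F t) : (N <= k + t)%N ->
    aug_d F t \o act (D k) y1 = 0 ->
    exists x : 'I_(s k.+2) -> F t,
      aug_d F t \o y1 = aug_d F t \o act (D k.+1) x.
  move=> Nk Dy.
  have [y1 y1E] := vector_lift (fun i => aug_d_surj (P := F) (y i)).
  have [||x xE] := shift 0%N y1; first by rewrite addn0.
    by rewrite act_map y1E.
  by exists (aug_d F 0 \o x); rewrite -act_map -xE.
elim: k t y1 {y} => [|k IH] t y1 Nk dDy1.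
- have [y2 y2E] : exists y2, aug_d F t.+1 \o y2 = act (D 0) y1.
    apply: vector_lift => i; apply/(aug_d_exact (P := F) (n := t)).
    by have /(congr1 (fun f => f i)) := dDy1.
  have [|x ->] := flat_column_exact (Fflat t) (@Dex 0) (y := y1).
    rewrite -y2E; apply/funext => i.
    by rewrite /= (F0 t.+1 _ (y2 i)) ?ltnS // linear0.
  by exists x.
have [y2 y2E] : exists y2, aug_d F t.+1 \o y2 = act (D k.+1) y1.
  apply: vector_lift => i; apply/(aug_d_exact (P := F) (n := t)).
  by have /(congr1 (fun f => f i)) := dDy1.
have [||x xE] := IH t.+1 y2; first by rewrite addnS -addSn.
  by rewrite act_map y2E -actM DD act0mx.
have [|z zE] := flat_column_exact (Fflat t) (@Dex k.+1)
  (y := y1 - (aug_d F t.+1 \o x)).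
  by rewrite actB -act_map -xE y2E subrr.
exists z; rewrite -zE; apply/funext => i /=.
have -> : (y1 - (aug_d F t.+1 \o x)) i = y1 i - aug_d F t.+1 (x i) by [].
by rewrite linearB (aug_dd (P := F)) subr0.
Qed.

End TorVanishing.

(** * The mapping cone *)

Section Cone.
Variable R : nzRingType.
Variable I : coresolution (R^o : lmodType R).
Hypotheses (Iinj : forall n, injective_module (I n))
           (Ifd : forall i, flat_dim_le (I i) i.+1).
Variable g : nat.

Variables (r : nat -> nat) (E : forall k, 'M[R]_(r k, r k.+1)).
Hypotheses (EE : forall k, E k *m E k.+1 = 0)
  (Ecol : forall k, column_exact (E k.+1) (E k.+2))
  (Erow : forall k, k <> g -> forall v : 'rV_(r k.+1),
    v *m E k.+1 = 0 -> exists w, v = w *m E k)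
  (rg : r g.+2 = 0%N).

Variables (q : nat -> nat) (C : forall k, 'M[R]_(q k, q k.+1)).
Hypotheses (q0 : q 0%N = 0%N)
  (CC : forall k, C k *m C k.+1 = 0)
  (Ccol : forall k, column_exact (C k.+1) (C k.+2)).

(** The squares anticommute, so the blocks of the cone carry no signs. [Phi_mono] and [Phi_epi] say
    that Phi identifies the cokernel of [C 1] with the homology of [E] at [r 1]. *)
Variable Phi : forall k, 'M[R]_(r k.+1, q k.+1).
Hypotheses (E0Phi : E 0 *m Phi 0 = 0)
  (EPhi : forall k, E k.+1 *m Phi k.+1 = - (Phi k *m C k.+1))
  (Phi_mono : forall (u : 'I_(q 1) -> R^o) (w : 'I_(r 2) -> R^o),
    act (Phi 0) u = act (E 1) w -> exists z : 'I_(q 2) -> R^o, u = act (C 1) z)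
  (Phi_epi : forall x : 'I_(r 1) -> R^o, act (E 0) x = 0 ->
    exists (u : 'I_(q 1) -> R^o) (w : 'I_(r 2) -> R^o),
      x = act (Phi 0) u + act (E 1) w).

(** As [q 0 = 0], the module Q_i has rank [q i.+1] and lies in degree i + 2, and degrees 0 and 1
    come from [E] alone. *)
Let s k := if k is k'.+1 then (q k' + r k'.+1)%N else r 0.
Let D k : 'M[R]_(s k, s k.+1) :=
  match k with
  | 0 => row_mx 0 (E 0)
  | k'.+1 => block_mx (C k') 0 (Phi k') (E k'.+1)
  end.

Let cone_dd k : D k *m D k.+1 = 0.
Proof.
case: k => [|k] /=.
  by rewrite mul_row_block !mul0mx !add0r E0Phi EE row_mx0.
rewrite mulmx_block !mul0mx !mulmx0 !addr0 add0r CC EE EPhi addrN.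
exact: block_mx0.
Qed.

(** The only homologies to cancel are those of [E] at [r 1] and of [C] at [q 1]: [Phi_epi] settles k
    = 0, [Phi_mono] k = 1, and [Ccol] with [Ecol] the rest. *)
Let cone_exact k : column_exact (D k) (D k.+1).
Proof.
move=> x; have [y [z ->]] : exists y z, x = pair_vec y z := pair_vecP x.
case: k x y z => [|k] _ y z /=.
  rewrite act_row_mx act0mx add0r => /Phi_epi[u [w ->]].
  exists (pair_vec u w); rewrite act_block_mx pair_vec_eq; split=> //.
  exact: vector0.
rewrite act_block_mx act0mx addr0 pair_vec_eq0 => -[Cy yz].
have [u yE] : exists u, y = act (C k.+1) u.
  case: k y z Cy yz => [|k] y z Cy yz; last exact: Ccol.
  apply: (@Phi_mono y (- z)); rewrite actN; apply/eqP.
  by rewrite -addr_eq0 yz.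
have [|w wE] := @Ecol k (z - act (Phi k.+1) u).
  by rewrite actB -[act _ (act _ _)]actM EPhi actNmx opprK actM -yE addrC.
exists (pair_vec u w); rewrite act_block_mx act0mx addr0 -yE -wE.
by rewrite addrCA subrr addr0.
Qed.

(* By injectivity of [I l], [Phi i] applied to [y] equals [E (i + 1)] applied to
   some [p]; then [(y, - p)] is a cycle of the cone tensored with [I l]. *)
Lemma cone_hom_zero i l (y : 'I_(q i.+1) -> I l) :
  i <> g -> (l <= i)%N -> act (C i) y = 0 -> exists z, y = act (C i.+1) z.
Proof.
move=> ig li Cy.
pose f : {linear 'rV[R]_(r i.+1) -> I l} := rdot (act (Phi i) y).
pose d : {linear 'rV[R]_(r i.+1) -> 'rV[R]_(r i.+2)} := mulmxr (E i.+1).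
have EPhiy : act (E i) (act (Phi i) y) = 0.
  rewrite -actM; case: i {f d li ig} y Cy => [|k] y Cy;
    first by rewrite E0Phi act0mx.
  by rewrite EPhi actNmx actM Cy act0 oppr0.
(* [f] kills the kernel of [d]: since i <> g this kernel consists of rows [w *m E i], and E i
   annihilates Phi i y. *)
have [v /(Erow ig)[w ->]|h hE] := @injective_extension R _ _ _ d f (@Iinj l).
  by rewrite /f /= rdot_mul EPhiy; apply: big1 => j _; rewrite scaler0.
pose p j := h (delta_mx 0 j).
have Ep : act (E i.+1) p = act (Phi i) y.
  apply/funext => j; rewrite -[RHS]rdot_delta -[RHS]hE -rdot_row.
  by rewrite -linear_rdot rowE.
have [||x] := @tor_vanishing R s D cone_dd cone_exact (I l) l.+1 i.+1
  (pair_vec y (- p)) (@Ifd l); first by [].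
  rewrite act_block_mx act0mx addr0 actN Ep Cy pair_vec_eq0; split=> //.
  exact: subrr.
have [z [w ->]] : exists z w, x = pair_vec z w := pair_vecP x.
rewrite act_block_mx act0mx addr0 => /pair_vec_eq[-> _]; by exists z.
Qed.

Let J := coaug_obj I.
Let d k : {linear J k -> J k.+1} := coaug_d I k.

(** The matrix form of Ext^g(Ext^g(N, R), R) = 0: [d g \o y] induces a map from Ext^g(N, R) to the
    cycles of I_g, and [h] is its lift to J_g, given on all of R^(q g.+1). *)
Hypothesis Hg : forall y : 'I_(q g.+1) -> J g, act (C g) (d g \o y) = 0 ->
  exists h : 'I_(q g.+1) -> J g, [/\ act (C g) h = 0, g = 0%N -> h = 0 &
    forall a, a *m C g.+1 = 0 -> d g (rdot y a) = d g (rdot h a)].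

(* Upwards along the recursion [d y] is lifted through [C] by [cone_hom_zero];
   downwards [t] is obtained from the exactness of [I]. *)
Let descent n j (y : 'I_(q j.+1) -> J j) : (j + n)%N = g ->
  act (C j) (d j \o y) = 0 ->
  exists (y' : 'I_(q j.+1) -> J j) (t : 'I_(r j.+2) -> J j),
    [/\ act (C j) y' = act (C j) y, j = 0%N -> y' = y &
        d j \o act (Phi j) y' = - act (E j.+1) (d j \o t)].
Proof.
elim: n j y => [|n IH] j y.
  rewrite addn0 => jg Cdy; subst j.
  have [h [Ch h0 hE]] := Hg Cdy.
  exists (y - h), 0; rewrite actB Ch subr0; split=> // [/h0 ->|].
    by rewrite subr0.
  have -> : d g \o (0 : 'I_(r g.+2) -> J g) = 0.
    by apply/funext => i; exact: linear0.
  rewrite act0 oppr0 actB; apply/funext => i.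
  transitivity (d g (act (Phi g) y i - act (Phi g) h i)) => //.
  rewrite -!rdot_row linearB.
  (* As [E] has ended ([r g.+2 = 0]), the rows of [Phi g] are cocycles, where d y and d h agree. *)
  have PhiC : Phi g *m C g.+1 = 0.
    apply/oppr_inj; rewrite -EPhi oppr0; apply/matrixP => a b.
    rewrite !mxE big1 // => c _; have := ltn_ord c.
    by rewrite [X in (_ < X)%N]rg.
  by rewrite hE ?subrr // -row_mul PhiC row0.
move=> jn Cdy; have jg : j <> g.
  by move=> jg; move: jn; rewrite -jg -{2}[j]addn0 => /addnI.
have [y1 dyE] := cone_hom_zero jg (leqnn j) Cdy.
have [||y' [t [Cy' _ tE]]] := IH j.+1 y1; first by rewrite addSn -addnS.
  rewrite -act_map -dyE; apply/funext => i; exact: coaug_dd.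
have [t' t'E] : exists t', d j \o t' = act (Phi j.+1) y' + act (E j.+2) t.
  apply: vector_lift => i; apply/(coaug_d_exact (I := I) (n := j)).
  move: tE; rewrite -act_map => /(congr1 (fun f => f i)) tEi.
  rewrite -[X in coaug_d I _ X]/(act (Phi j.+1) y' i + act (E j.+2) t i).
  by apply/eqP; rewrite linearD addr_eq0; apply/eqP.
exists y, t'; split=> //.
rewrite act_map dyE -Cy' t'E actD -[act (E j.+1) (act (E j.+2) t)]actM EE.
by rewrite act0mx addr0 -!actM EPhi actNmx opprK.
Qed.

(** The descent begins at j = 0, where its condition is empty because [q 0 = 0] and where [y' = y];
    injectivity of R -> I_0 then removes [d 0]. *)
Theorem cone_comparison_zero (y : 'I_(q 1) -> R^o) :
  exists t : 'I_(r 2) -> R^o, act (Phi 0) y = act (E 1) t.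
Proof.
have [||y' [t [_ /(_ erefl) -> dE]]] := @descent g 0 y; first by rewrite add0n.
  exact: vector0.
exists (- t); apply/funext => i; apply: (@coaug_d_inj _ _ I).
rewrite actN; have /(congr1 (fun f => f i)) /= := dE; rewrite -act_map => ->.
by rewrite [RHS]linearN.
Qed.

End Cone.

(** * The reversed dual of a finite free resolution *)

Section Reversal.
Variables (R : nzRingType) (m : nat -> nat) (B : forall k, 'M[R]_(m k.+1, m k)).

(* [B (N - 1), ..., B 0] followed by zeros; recursion keeps the dimensions
   convertible, which [m (N - k)] would not. *)
Fixpoint rev_dim (N k : nat) {struct k} : nat :=
  match k with
  | 0 => m N
  | k'.+1 => match N with 0 => 0%N | N'.+1 => rev_dim N' k' end
  end.

Fixpoint rev_mx (N k : nat) {struct k} : 'M[R]_(rev_dim N k, rev_dim N k.+1) :=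
  match k return 'M[R]_(rev_dim N k, rev_dim N k.+1) with
  | 0 => match N return 'M[R]_(rev_dim N 0, rev_dim N 1) with
         | 0 => 0
         | N'.+1 => B N'
         end
  | k'.+1 => match N return 'M[R]_(rev_dim N k'.+1, rev_dim N k'.+2) with
             | 0 => 0
             | N'.+1 => rev_mx N' k'
             end
  end.

Lemma rev_dim_last N : rev_dim N N = m 0.
Proof. by elim: N. Qed.

Lemma rev_mx_mul N k : (forall j, B j.+1 *m B j = 0) ->
  rev_mx N k *m rev_mx N k.+1 = 0.
Proof.
move=> BB; elim: k N => [|k IH] [|N]; rewrite ?mul0mx //; last exact: IH.
by case: N => [|N]; [exact: mulmx0 | exact: BB].
Qed.

Hypothesis m0 : m 0 = 0%N.

Let row0_exact n k (A : 'M[R]_(k, n)) (v : 'rV[R]_n) :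
  n = 0%N -> exists w, v = w *m A.
Proof.
by move=> n0; exists 0; move: A v; rewrite n0 => A v; rewrite !thinmx0.
Qed.

(** The excluded index k + 2 = N is the place of R^(m 1), where the cokernel is the resolved module;
    further on all ranks are 0. *)
Lemma rev_mx_row_exact N k (v : 'rV[R]_(rev_dim N k.+1)) :
  (forall j (v : 'rV[R]_(m j.+2)), v *m B j.+1 = 0 ->
    exists w, v = w *m B j.+2) ->
  k.+2 <> N -> v *m rev_mx N k.+1 = 0 -> exists w, v = w *m rev_mx N k.
Proof.
move=> BP; elim: k N v => [|k IH] [|N] v; try by move=> *; exact: row0_exact.
  case: N v => [|[|N]] v kN; [by move=> _; exact: row0_exact | by [] |].
  exact: BP.
by move=> kN; apply: IH => kN'; apply: kN; rewrite kN'.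
Qed.

Lemma rev_mx_column_exact N k :
  (forall j, (j.+1 < N)%N -> column_exact (B j.+1) (B j)) ->
  column_exact (rev_mx N k) (rev_mx N k.+1).
Proof.
elim: k N => [|k IH] [|N] BP.
- by move=> x _; exists 0; exact: vector0.
- case: N BP => [|N] BP; last exact: BP.
  move=> x _; exists 0; exact: vector0.
- by move=> x _; exists 0; exact: vector0.
by apply: IH => j jN; apply: BP; exact: ltnW.
Qed.

End Reversal.

(** * Right modules through transposed matrices *)

Section ExtOp.
Variables (R : nzRingType) (V : lmodType R^c) (q : nat -> nat).
Variables (B : forall k, 'M[R^c]_(q k.+1, q k)).
Variable a : {linear 'rV[R^c]_(q 1%N) -> V}.
Hypothesis Bres : matrix_resolution B a.

Let C k : 'M[R]_(q k, q k.+1) := (B k)^T.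

Lemma mulmx_converse n p (v : 'rV[R^c]_n) (A : 'M[R^c]_(n, p)) j :
  (v *m A) 0 j = act (A^T : 'M[R]_(p, n)) (fun k => v 0 k : R^o) j.
Proof. by rewrite mxE; apply: eq_bigr => k _; rewrite mxE. Qed.

Lemma act_converse n p (y : 'I_p -> R^c^o) (A : 'M[R^c]_(n, p)) i :
  act A y i =
  ((\row_j (y j : R) : 'rV[R]_p) *m (A^T : 'M[R]_(p, n))) 0 i :> R.
Proof. by rewrite mxE; apply: eq_bigr => k _; rewrite !mxE. Qed.

(** Over R^c products are reversed, so a matrix over R^c acting on columns is its transpose over R
    acting on rows from the right. Thus Ext over the opposite ring becomes the cohomology of rows
    under [C], with its left R-structure. *)
Lemma ext_op_matrix i :
  exists cls : {linear kernel (mulmxr (C i.+1) :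
      {linear 'rV[R]_(q i.+1) -> 'rV[R]_(q i.+2)}) -> ext_op i V},
    (forall e, exists z, cls z = e) /\
    forall z, cls z = 0 <-> exists w, val z = w *m C i.
Proof.
have [cls [clsD clsZ cls_surj cls0]] := ext_matrix Bres i.
pose col n (v : 'rV[R]_n) : 'I_n -> R^c^o := fun j => v 0 j.
have colK n (v : 'rV[R]_n) : \row_j col n v j = v :> 'rV[R]_n.
  by apply/rowP => j; rewrite mxE.
have act_col k (v : 'rV[R]_(q k)) : act (B k) (col _ v) = col _ (v *m C k).
  by apply/funext => j; rewrite [LHS]act_converse colK.
have cyc z : z \in ker_pred (mulmxr (C i.+1)) -> act (B i.+1) (col _ z) = 0.
  by move=> /eqP z0; rewrite act_col [_ *m _]z0; apply/funext => j; exact: mxE.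
pose K := kernel
  (mulmxr (C i.+1) : {linear 'rV[R]_(q i.+1) -> 'rV[R]_(q i.+2)}).
have Kcyc (z : K) : act (B i.+1) (col _ (val z)) = 0.
  by apply: cyc; rewrite inE; apply/eqP/kernelP.
have lin : linear (fun z : K => cls (col _ (val z)) : ext_op i V).
  move=> c x y; rewrite -[RHS]/((c : R^c^c) *: cls _ + cls _).
  rewrite -clsZ // -clsD //.
    by congr cls; apply/funext => j; rewrite /col /= !mxE.
  have -> : (fun j => (col _ (val x) j : R^c) * (c : R^c) : R^c^o) =
      col _ (val (c *: x)).
    by apply/funext => j; rewrite /col /= !mxE.
  exact: Kcyc.
exists (linear_of lin); split=> [e|z].
  have [y [y0 <-]] := cls_surj e.
  have yK : (\row_j (y j : R) : 'rV[R]_(q i.+1)) \in ker_pred (mulmxr (C i.+1)).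
    rewrite inE /=; apply/eqP/rowP => j; rewrite [RHS]mxE.
    by have /(congr1 (fun f => f j)) := y0; rewrite act_converse.
  exists (Kernel yK); rewrite /= /linear_fun; congr cls.
  by apply/funext => j; rewrite /col /= mxE.
apply: (iff_trans (cls0 _ (Kcyc z))); split=> -[w wE].
  exists (\row_j (w j : R)); apply/rowP => j.
  have /(congr1 (fun f => f j)) := wE; rewrite act_converse => <-.
  by [].
by exists (col _ w); rewrite act_col -wE.
Qed.

End ExtOp.

Lemma surjective_factor (R : nzRingType) (A B C : lmodType R)
    (p : {linear A -> B}) (f : {linear A -> C}) :
  (forall b, exists a, p a = b) -> (forall a, p a = 0 -> f a = 0) ->
  exists h : {linear B -> C}, forall a, h (p a) = f a.
Proof.
move=> /choice[s sP] pf.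
have fs a : f (s (p a)) = f a.
  apply/eqP; rewrite -subr_eq0 -linearB; apply/eqP/pf.
  by rewrite linearB sP subrr.
have lin : linear (f \o s).
  by move=> c x y; rewrite /= -linearP -[RHS]fs linearP !sP.
by exists (linear_of lin).
Qed.

Lemma act_delta (R : nzRingType) m n (A : 'M[R]_(m, n)) i j :
  act A (fun k => (k == j)%:R : R^o) i = A i j.
Proof.
rewrite /act (bigD1 j) //= eqxx big1 ?addr0 => [|k /negPf ->];
  exact: mulr1 || exact: mulr0.
Qed.

Lemma column_lift (R : nzRingType) m n p (E : 'M[R]_(m, n)) (A : 'M[R]_(m, p)) :
  (forall u : 'I_p -> R^o, exists w : 'I_n -> R^o, act A u = act E w) ->
  exists X : 'M[R]_(n, p), E *m X = A.
Proof.
move=> EA; have [w wE] := choice (fun j => EA (fun k => (k == j)%:R)).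
exists (\matrix_(i, j) w j i); apply/matrixP => i j.
rewrite -[RHS]act_delta wE mxE; apply: eq_bigr => k _.
by rewrite mxE.
Qed.

Section ChainMap.
Variables (R : nzRingType) (r q : nat -> nat).
Variable E : forall k, 'M[R]_(r k, r k.+1).
Variable C : forall k, 'M[R]_(q k, q k.+1).
Hypotheses (Ecol : forall k, column_exact (E k.+1) (E k.+2))
           (CC : forall k, C k *m C k.+1 = 0).
Variable Phi0 : 'M[R]_(r 1, q 1).
Hypothesis Phi0C : forall u : 'I_(q 2) -> R^o,
  exists w : 'I_(r 2) -> R^o, act (Phi0 *m C 1) u = act (E 1) w.

(** [E] may have homology at [r 1], so the first component is given with its lifting condition
    [Phi0C]; later ones are solved column by column. *)
Lemma column_chain_map : exists Phi : forall k, 'M[R]_(r k.+1, q k.+1),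
  Phi 0 = Phi0 /\ forall k, E k.+1 *m Phi k.+1 = - (Phi k *m C k.+1).
Proof.
pose good k (F : 'M[R]_(r k.+1, q k.+1)) := forall u : 'I_(q k.+2) -> R^o,
  exists w : 'I_(r k.+2) -> R^o, act (F *m C k.+1) u = act (E k.+1) w.
pose rel k (F : 'M[R]_(r k.+1, q k.+1)) (F' : 'M[R]_(r k.+2, q k.+2)) :=
  E k.+1 *m F' = - (F *m C k.+1).
have [//|k F Fgood|Phi [Phi0E PhiP]] :=
  @dependent_choice (fun k => 'M[R]_(r k.+1, q k.+1)) good rel Phi0.
  have [u|F' F'E] := @column_lift _ _ _ _ (E k.+1) (- (F *m C k.+1)).
    by have [w wE] := Fgood u; exists (- w); rewrite actNmx actN wE.
  (* The invariant passes on because E F' C = - F C C = 0 and [E] is exact there. *)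
  exists F'; split=> // u; apply: Ecol.
  by rewrite -actM mulmxA F'E mulNmx -mulmxA CC mulmx0 oppr0 act0mx.
by exists Phi; split=> // k; case: (PhiP k).
Qed.

End ChainMap.

(** * Vanishing off the grade and non-vanishing at the grade *)

Section Main.
Variables (R : nzRingType) (M : lmodType R) (g : nat).
Hypotheses (Rl : left_noetherian R) (Rr : right_noetherian R).
Variable I : coresolution (R^o : lmodType R).
Hypotheses (Iinj : forall n, injective_module (I n))
           (Ifd : forall i, flat_dim_le (I i) i.+1).
Hypotheses (M_fg : finitely_generated M) (M_grade : grade_ge M g).

Let N := ext g M.

(** N is a quotient of the cocycles, a right submodule of a finite free module; [col] turns rows
    over R^c into columns over R. *)
Lemma ext_finitely_generated : finitely_generated N.
Proof.
have [m [B [a Bres]]] := matrix_resolution_exists Rl M_fg.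
have [cls [clsD clsZ cls_surj cls0]] := ext_matrix Bres g.
pose col (v : 'rV[R^c]_(m g.+1)) : 'I_(m g.+1) -> R^o := fun j => v 0 j.
have [|n [G GP]] := @noetherian_generators R^c _
    (fun v => act (B g.+1) (col v) = 0) Rr.
  split=> [|c x y x0 y0].
    by apply/funext => i; apply: big1 => j _; rewrite /col mxE scaler0.
  apply/funext => i.
  transitivity ((act (B g.+1) (col x) i : R) * c + act (B g.+1) (col y) i).
    rewrite mulr_suml -big_split; apply: eq_bigr => j _.
    by rewrite /col !mxE scalerDr; congr (_ + _); exact: mulrA.
  by rewrite x0 y0 addr0; exact: mul0r.
have Gcyc i : act (B g.+1) (col (row i G)) = 0.
  by apply/GP; exists (delta_mx 0 i); rewrite rowE.
have cyc0 : act (B g.+1) (0 : _ -> R^o) = 0 by exact: act0.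
have cls00 : cls 0 = 0 by apply/cls0 => //; exists 0; rewrite act0.
exists n, (fun i => cls (col (row i G))) => e.
have [y [y0 <-]] := cls_surj e.
have [w wE] : exists w, \row_j (y j : R^c) = w *m G.
  apply/GP; rewrite -y0; congr act; apply/funext => j; exact: mxE.
exists (fun i => w 0 i).
have yE : y = \sum_i (fun j => (col (row i G) j : R) * (w 0 i : R) : R^o).
  apply/funext => j; rewrite fct_sumE.
  have /rowP/(_ j) := wE; rewrite !mxE => ->.
  by apply: eq_bigr => i _; rewrite /col mxE.
suff [] : act (B g.+1) y = 0 /\
    cls y = \sum_(i < n) (w 0 i : R^c) *: cls (col (row i G)) by [].
rewrite yE; elim/big_ind2: _ => // [y1 e1 y2 e2 [c1 <-] [c2 <-]|i _].
  by rewrite actD c1 c2 addr0 clsD.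
rewrite clsZ //; split=> //; apply/funext => k.
transitivity ((act (B g.+1) (col (row i G)) k : R) * (w 0 i : R)).
  by rewrite mulr_suml; apply: eq_bigr => j _; exact: mulrA.
by rewrite Gcyc; exact: mul0r.
Qed.

Section Resolutions.
Variables (m : nat -> nat) (B : forall k, 'M[R]_(m k.+1, m k)).
Variable (aM : {linear 'rV[R]_(m 1) -> M}).
Hypothesis Bres : matrix_resolution B aM.
Variables (q : nat -> nat) (Q : forall k, 'M[R^c]_(q k.+1, q k)).
Variable aN : {linear 'rV[R^c]_(q 1) -> N}.
Hypothesis Qres : matrix_resolution Q aN.

(** Starting at g + 2 makes [E 0] and [E 1] convertible to [B g.+1] and [B g], whose homology is N,
    and gives [r g.+2 = m 0 = 0]. *)
Let r := rev_dim m g.+2.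
Let E := rev_mx B g.+2 : forall k, 'M[R]_(r k, r k.+1).
Let C k : 'M[R]_(q k, q k.+1) := (Q k)^T.

Let m0 : m 0 = 0%N. Proof. by case: Bres. Qed.
Let q0 : q 0 = 0%N. Proof. by case: Qres. Qed.

Let E_mul k : E k *m E k.+1 = 0.
Proof.
apply: rev_mx_mul => -[|j].
  apply/matrixP => a b; have := ltn_ord b.
  by rewrite [X in (_ < X)%N]m0.
have [_ _ _ BP] := Bres; apply/row_matrixP => a.
by rewrite row_mul row0; apply/BP; exists (delta_mx 0 a); rewrite rowE.
Qed.

Let E_col k : column_exact (E k.+1) (E k.+2).
Proof.
(* Dropping [E 0] amounts to reversing from g + 1, so only indices j < g occur, where Ext^j(M, R) =
   0. *)
apply: (@rev_mx_column_exact R m B m0 g.+1 k) => j jg x xcyc.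
have [cls [_ _ _ cls0]] := ext_matrix Bres j.
by apply/cls0 => //; exact: M_grade.
Qed.

Let E_row k : k <> g -> forall v : 'rV_(r k.+1),
  v *m E k.+1 = 0 -> exists w, v = w *m E k.
Proof.
move=> kg v; apply: rev_mx_row_exact => // [j w|[kg']]; last exact: kg.
by have [_ _ _ BP] := Bres; move/BP.
Qed.

Let C_mul k : C k *m C k.+1 = 0.
Proof.
case: k => [|k].
  apply/matrixP => a; have := ltn_ord a.
  by rewrite [X in (_ < X)%N]q0.
have [_ _ _ QP] := Qres.
have QQ : Q k.+2 *m Q k.+1 = 0.
  apply/row_matrixP => a.
  by rewrite row_mul row0; apply/QP; exists (delta_mx 0 a); rewrite rowE.
apply/matrixP => i j; have /matrixP/(_ j i) := QQ; rewrite !mxE => QQji.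
by rewrite -[RHS]QQji; apply: eq_bigr => l _; rewrite !mxE.
Qed.

Let row_of n (u : 'I_n -> R^o) : 'rV[R^c]_n := \row_j (u j : R).

Let row_of_act n p (A : 'M[R^c]_(n, p)) (u : 'I_n -> R^o) :
  row_of (act (A^T : 'M[R]_(p, n)) u) = row_of u *m A.
Proof.
apply/rowP => j; rewrite mxE mulmx_converse.
by apply: eq_bigr => k _; rewrite !mxE.
Qed.

Let row_of_inj n : injective (@row_of n).
Proof.
by move=> u v /rowP uv; apply/funext => j; have := uv j; rewrite !mxE.
Qed.

Let row_of_surj n (w : 'rV[R^c]_n) : exists u, w = row_of u.
Proof. by exists (fun j => w 0 j); apply/rowP => j; rewrite mxE. Qed.

Let C_col k : column_exact (C k.+1) (C k.+2).
Proof.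
move=> x Cx; have [_ _ _ QP] := Qres.
have /QP[w] : row_of x *m Q k.+1 = 0.
  by rewrite -row_of_act [act _ _]Cx; apply/rowP => j; rewrite !mxE.
have [u ->] := row_of_surj w; rewrite -row_of_act => /row_of_inj xE.
by exists u.
Qed.

(** [Phi] lifts the identity of N: the columns of [Phi 0] are cocycles that represent the generators
    [aN (delta_mx 0 j)]. *)
Lemma ext_comparison_map : exists (cls : ('I_(r 1) -> R^o) -> N)
    (Phi : forall k, 'M[R]_(r k.+1, q k.+1)),
  [/\ forall e, exists x, act (E 0) x = 0 /\ cls x = e,
      forall x, act (E 0) x = 0 ->
        (cls x = 0 <-> exists z : 'I_(r 2) -> R^o, x = act (E 1) z),
      E 0 *m Phi 0 = 0,
      forall k, E k.+1 *m Phi k.+1 = - (Phi k *m C k.+1) &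
      (forall (u : 'I_(q 1) -> R^o) (w : 'I_(r 2) -> R^o),
        act (Phi 0) u = act (E 1) w ->
        exists z : 'I_(q 2) -> R^o, u = act (C 1) z) /\
      (forall x : 'I_(r 1) -> R^o, act (E 0) x = 0 ->
        exists (u : 'I_(q 1) -> R^o) (w : 'I_(r 2) -> R^o),
          x = act (Phi 0) u + act (E 1) w)].
Proof.
have [cls [clsD clsZ cls_surj cls0]] := ext_matrix Bres g.
rewrite -/(E 0) -/(E 1) -/(r 1) in cls clsD clsZ cls_surj cls0 *.
have [_ aN_surj aN0 _] := Qres.
have [y yP] := choice (fun j : 'I_(q 1) => cls_surj (aN (delta_mx 0 j))).
pose Phi0 : 'M[R]_(r 1, q 1) := \matrix_(i, j) y j i.
have Phi0E u : act (E 0) (act Phi0 u) = 0 /\ cls (act Phi0 u) = aN (row_of u).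
  have cls00 : cls 0 = 0 by apply/cls0; [exact: act0 | exists 0; rewrite act0].
  have -> : act Phi0 u = \sum_j (fun i => (y j i : R) * (u j : R) : R^o).
    by apply/funext => i; rewrite fct_sumE; apply: eq_bigr => j _; rewrite mxE.
  rewrite [row_of u]row_sum_delta linear_sum.
  elim/big_ind2: _ => [|y1 e1 y2 e2 [c1 <-] [c2 <-]|j _].
  - by split=> //; exact: act0.
  - by rewrite actD c1 c2 addr0 clsD.
  have [yj0 yjE] := yP j; rewrite clsZ // yjE linearZ mxE; split=> //.
  apply/funext => k.
  transitivity ((act (E 0) (y j) k : R) * (u j : R)).
    by rewrite mulr_suml; apply: eq_bigr => i _; exact: mulrA.
  by rewrite yj0; exact: mul0r.
have Phi0_mono u : (exists w : 'I_(r 2) -> R^o, act Phi0 u = act (E 1) w) <->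
    exists z : 'I_(q 2) -> R^o, u = act (C 1) z.
  have [Eu clsu] := Phi0E u; rewrite -cls0 // clsu aN0; split=> -[w wE].
    have [z zE] := row_of_surj w; exists z; apply: row_of_inj.
    by rewrite wE zE row_of_act.
  by exists (row_of w); rewrite wE row_of_act.
have [u|Phi [PhiE Phi_chain]] := column_chain_map E_col C_mul (Phi0 := Phi0).
  by rewrite actM; apply/Phi0_mono; exists u.
exists cls, Phi; split; rewrite ?PhiE //.
  by apply/matrixP => i j; rewrite [RHS]mxE -[LHS]act_delta actM (Phi0E _).1.
split=> [u w uw|x Ex]; first by apply/Phi0_mono; exists w.
have [v vE] := aN_surj (cls x); have [u uE] := row_of_surj v.
have [Eu clsu] := Phi0E u; exists u.
have Exu : act (E 0) (x - act Phi0 u) = 0 by rewrite actB Ex Eu subrr.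
have /(cls0 _ Exu)[w wE] : cls (x - act Phi0 u) = 0.
  apply: (@addIr _ (cls (act Phi0 u))).
  by rewrite -clsD // subrK add0r clsu -uE vE.
by exists w; rewrite -wE addrC subrK.
Qed.

Let X i := ext_op i N.

Let ext_op_cocycle i : lmodType R := kernel (mulmxr (C i.+1) :
  {linear 'rV[R]_(q i.+1) -> 'rV[R]_(q i.+2)}).

(** Injectivity extends [f \o cls] from the cocycles to the whole row space; [C i] kills [y] because
    its rows are coboundaries. *)
Let row_extension i (cls : {linear ext_op_cocycle i -> X i}) (A : lmodType R)
    (f : {linear X i -> A}) :
  injective_module A -> (forall z, cls z = 0 <-> exists w, val z = w *m C i) ->
  exists y : 'I_(q i.+1) -> A,
    act (C i) y = 0 /\ forall z, f (cls z) = rdot y (val z).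
Proof.
move=> Ainj cls0.
have val_lin : linear (fun z : ext_op_cocycle i => val z) by [].
have [h hE] := Ainj _ _ (linear_of val_lin) (f \o cls) val_inj.
exists (fun j => h (delta_mx 0 j)); split; last first.
  by move=> z; rewrite -linear_rdot; exact: (esym (hE z)).
apply/funext => j; rewrite -rdot_row -linear_rdot.
have rowK : row j (C i) \in ker_pred (mulmxr (C i.+1)).
  by rewrite inE /= -row_mul C_mul row0.
have := hE (Kernel rowK); rewrite /= /linear_fun /= => ->.
rewrite (_ : cls _ = 0) ?linear0 //; apply/cls0.
by exists (delta_mx 0 j); rewrite -rowE.
Qed.

Lemma ext_ext_op_zero i : i <> g -> zero_module (ext i (X i)).
Proof.
move=> ig; have [cls [cls_surj cls0]] := ext_op_matrix Qres i.
have [_ [Phi [_ _ E0Phi EPhi [Phi_mono Phi_epi]]]] := ext_comparison_map.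
apply: (ext_zero_of_hom Iinj) => f x.
have [y [Cy fE]] := row_extension f (@Iinj i) cls0.
have [z yE] := cone_hom_zero Iinj Ifd E_mul E_col E_row q0 C_mul C_col
  E0Phi EPhi Phi_mono Phi_epi ig (leqnn i) Cy.
have [e <-] := cls_surj x; rewrite fE yE -rdot_mul.
have -> : val e *m C i.+1 = 0 by exact: (kernelP e).
exact: linear0.
Qed.

Lemma ext_ext_op_nonzero : zero_module (ext g (X g)) -> zero_module N.
Proof.
move=> extX0; have [cls [cls_surj cls0]] := ext_op_matrix Qres g.
have [clsN [Phi [clsN_surj clsN0 E0Phi EPhi [Phi_mono Phi_epi]]]] :=
  ext_comparison_map.
have rg : r g.+2 = 0%N by rewrite /r rev_dim_last.
have factor (A : lmodType R) (y : 'I_(q g.+1) -> A) : act (C g) y = 0 ->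
    exists f : {linear X g -> A}, forall z, f (cls z) = rdot y (val z).
  move=> Cy.
  have lin : linear (fun z : ext_op_cocycle g => rdot y (val z)).
    by move=> c z z'; rewrite !linearP.
  have [z /cls0[w zE]|f fE] := surjective_factor (f := linear_of lin) cls_surj.
    rewrite /= /linear_fun zE rdot_mul Cy.
    by apply: big1 => j _; rewrite scaler0.
  by exists f.
pose J := coaug_obj I; pose d k : {linear J k -> J k.+1} := coaug_d I k.
have rdot_d (y : 'I_(q g.+1) -> J g) a : rdot (d g \o y) a = d g (rdot y a).
  by rewrite linear_sum; apply: eq_bigr => j _; rewrite linearZ.
have kerK a : a *m C g.+1 = 0 -> a \in ker_pred (mulmxr (C g.+1)).
  by move=> a0; rewrite inE /= a0.
have Hg (y : 'I_(q g.+1) -> J g) : act (C g) (d g \o y) = 0 ->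
    exists h : 'I_(q g.+1) -> J g, [/\ act (C g) h = 0, g = 0%N -> h = 0 &
      forall a, a *m C g.+1 = 0 -> d g (rdot y a) = d g (rdot h a)].
  move=> Cdy; have [f fE] := factor _ _ Cdy.
  have [|h [hE h0]] := @ext_zero_lift _ _ _ Iinj g f extX0.
    move=> x; have [z <-] := cls_surj x.
    by rewrite fE rdot_d; exact: coaug_dd.
  (* For g > 0 the lift [h] extends from the cocycles since J_g = I_(g-1) is injective; for g = 0 it
     is zero and extends by zero. *)
  have Jinj k : k = 0%N \/ (k <> 0%N /\ injective_module (J k)).
    by case: k => [|k]; [left | right; split=> //; exact: Iinj].
  have [v [Cv [v0 vE]]] : exists v : 'I_(q g.+1) -> J g,
      act (C g) v = 0 /\ (g = 0%N -> v = 0) /\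
      forall z, h (cls z) = rdot v (val z).
    have [g0|[g_gt0 /row_extension vext]] := Jinj g.
      exists 0; split; first exact: act0; split=> // z.
      by rewrite h0 //; apply/esym/big1 => j _; rewrite scaler0.
    by have [v [Cv vE]] := vext _ _ h cls0; exists v.
  exists v; split=> // a /kerK aK.
  by rewrite -rdot_d -[a]/(val (Kernel aK)) -fE hE vE.
move=> e; have [x [Ex <-]] := clsN_surj e; apply/clsN0 => //.
have [u [w ->]] := Phi_epi x Ex.
have [t ->] := cone_comparison_zero Iinj Ifd E_mul E_col E_row rg q0 C_mul C_col
  E0Phi EPhi Phi_mono Phi_epi Hg u.
by exists (t + w); rewrite actD.
Qed.

End Resolutions.
End Main.

Theorem theorem3p2 (R : nzRingType) (M : lmodType R) (g : nat)
    (R_left_noetherian : left_noetherian R)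
    (R_right_noetherian : right_noetherian R)
    (R_gorenstein : left_quasi_infty_Gorenstein R)
    (M_fg : finitely_generated M)
    (M_grade : has_grade M g) :
  forall i : nat,
    zero_module (ext i (ext_op i (ext g M))) <-> i <> g.
Proof.
move=> i; have [I [[Iinj _ _] Ifd]] := R_gorenstein.
have [M_grade_ge N_nonzero] := M_grade.
have [m [B [a Bres]]] := matrix_resolution_exists R_left_noetherian M_fg.
have N_fg := ext_finitely_generated g R_left_noetherian R_right_noetherian M_fg.
have [q [Q [b Qres]]] := matrix_resolution_exists R_right_noetherian N_fg.
split=> [ext0 ig|]; last exact: (ext_ext_op_zero Iinj Ifd M_grade_ge Bres Qres).
apply: N_nonzero; rewrite ig in ext0.
exact: (ext_ext_op_nonzero Iinj Ifd M_grade_ge Bres Qres).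
Qed.
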